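(* Let $2<p<\infty$, let $X$ be a subspace of some $L_p$ space, denoted $L_p$, and let $\aleph$ be an uncountable cardinal. The following are equivalent: (1) $\ell_p(\aleph)$ embeds isometrically into $X$. (2) There is a subspace of $X$ that is isomorphic to $\ell_p(\aleph)$ and is complemented in $L_p$. (3) $\ell_p(\aleph)$ embeds isomorphically into $X$. (4) There is no one-to-one bounded linear operator from $X$ into any $L_p(\aleph')$ space with $\aleph'<\aleph$.
   Context: An $L_p$ space is a Banach space $L_p(\nu)$ with $\nu$ an arbitrary (not necessarily finite or $\sigma$-finite) measure. Subspaces are closed linear subspaces; embeddings are linear; a subspace is complemented if it is the range of a bounded linear projection. For an infinite cardinal $\aleph'$, a Banach space is called an $L_p(\aleph')$ space if it is isometric to an $\ell_p$-direct sum $(\sum_{\alpha\in\Gamma} L_p(\mu_\alpha))_p$ with $|\Gamma|\le\aleph'$ and each $\mu_\alpha$ a finite measure. For a cardinal $\aleph$, $\ell_p(\aleph)$ denotes $\ell_p(\Gamma)$ for a set $\Gamma$ of cardinality $\aleph$. *)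

(* Defs.v *)
From HB Require Import structures.
From mathcomp Require Import all_boot all_order all_algebra.
From mathcomp Require Import all_classical all_reals all_analysis.
From mathcomp Require Import measurable_realfun ess_sup_inf.

Set Implicit Arguments.
Unset Strict Implicit.
Unset Printing Implicit Defensive.

Import Order.TTheory GRing.Theory Num.Theory.
Import numFieldNormedType.Exports.

Local Open Scope classical_set_scope.
Local Open Scope ring_scope.

(* The library provides [LspaceType mu p1], the a.e. classes of measurable real *)
(* functions of finite L_p-norm, as a bare type. It is made here a normed space *)
(* over R, the operations being those of representatives in [LfunType mu p1].   *)
Section Lspace_normed.
Context d (T : measurableType d) (R : realType).
Variables (mu : {measure set T -> \bar R}) (p : \bar R) (p1 : (1 <= p)%E).

Local Notation Lp := (LspaceType mu p1).
Local Notation aefun := {mfun_ mu, T >-> measurableTypeR R}.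

Lemma ae_eq_Lnorm (f g : T -> R) :
  measurable_fun [set: T] f -> measurable_fun [set: T] g -> f = g %[ae mu] ->
  ('N[mu]_p[EFin \o f] = 'N[mu]_p[EFin \o g])%E.
Proof.
move=> mf mg fg.
have mpow (r : R) (h : T -> \bar R) : measurable_fun [set: T] h ->
    measurable_fun [set: T] (fun x => `|h x| `^ r)%E.
  move=> mh; apply: (@measurableT_comp _ _ _ _ _ _ (fun x => x `^ r)%E) => //=.
    exact: (measurableT_comp (measurable_poweR _)).
  exact: measurableT_comp.
have fgE : \forall x \ae mu, (abse \o (EFin \o f)) x = (abse \o (EFin \o g)) x.
  by apply: filterS fg => x /(_ I) /= ->.
rewrite unlock /Lnorm; move: p1; case: p => [r r1|_|].
- congr poweR; apply: ge0_ae_eq_integral => //.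
  + by apply: mpow; exact/measurable_EFinP.
  + by apply: mpow; exact/measurable_EFinP.
  + by move=> x _; exact: poweR_ge0.
  + by move=> x _; exact: poweR_ge0.
  + by apply: filterS fg => x /(_ I) /= -> _.
- by case: ifP => // _; exact: eq_ess_sup.
- by rewrite leNgt ltNyr.
Qed.

(* [LspaceType] quotients maps into [measurableTypeR R], which has the same    *)
(* carrier and measurable sets as [R] but another display.                     *)
Definition mfun_measurableTypeR (f : LfunType mu p1) :
    {mfun T >-> measurableTypeR R} :=
  HB.pack (f : T -> measurableTypeR R)
    (@isMeasurableFun.Build _ _ T (measurableTypeR R) f (@measurable_funPT _ _ _ _ f)).

Definition Lpi (f : LfunType mu p1) : aefun :=
  (\pi_(aefun) (mfun_measurableTypeR f))%qT.

Lemma LpiK (f : LfunType mu p1) : (repr (Lpi f) : T -> R) = f %[ae mu].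
Proof.
by apply/asboolP; rewrite -[`[< _ >]]/(ae_eq_op _ _ (mfun_measurableTypeR f)) -eqmodE reprK.
Qed.

Lemma measurable_repr (x : aefun) : measurable_fun [set: T] (repr x : T -> R).
Proof. exact: measurable_funPT (repr x). Qed.

Lemma Lpi_finite (f : LfunType mu p1) : finite_norm mu p (Lpi f).
Proof.
rewrite /finite_norm (@ae_eq_Lnorm (repr (Lpi f)) f).
- exact: Lfunction_finite.
- exact: measurable_repr.
- exact: measurable_funPT.
- exact: LpiK.
Qed.

Definition Lclass (f : LfunType mu p1) : Lp :=
  HB.pack (Lpi f) (isFinLebesgue.Build d T R mu p p1 (Lpi f) (Lpi_finite f)).

Lemma Lrepr_subproof (x : Lp) : (repr (x : aefun) : T -> R) \in Lfun mu p.
Proof.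
apply/andP; split; first by rewrite inE; exact: measurable_repr.
by rewrite inE; case: x => x [[]].
Qed.

Definition Lrepr (x : Lp) : LfunType mu p1 := Lfun_Sub p1 (Lrepr_subproof x).

Lemma Lspace_inj (x y : Lp) : x = y :> aefun -> x = y.
Proof.
case: x y => [x [[xP]]] [y [[yP]]] /= xy; case: _ / xy yP => yP.
by rewrite (Prop_irrelevance xP yP).
Qed.

Lemma LclassP (f g : LfunType mu p1) : Lclass f = Lclass g <->
  (f : T -> R) = g %[ae mu].
Proof.
split=> [[] /eqP|fg].
  by rewrite eqmodE => /asboolP.
by apply: Lspace_inj; apply/eqmodP/asboolP.
Qed.

Lemma LreprK : cancel Lrepr Lclass.
Proof.
move=> x; apply: Lspace_inj => /=; rewrite -[RHS]reprK; apply/eqmodP/asboolP.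
exact: ae_eq_refl.
Qed.

Lemma LclassK (f : LfunType mu p1) : (Lrepr (Lclass f) : T -> R) = f %[ae mu].
Proof. by apply/LclassP; rewrite LreprK. Qed.

HB.instance Definition _ := gen_eqMixin Lp.
HB.instance Definition _ := gen_choiceMixin Lp.

Definition Lspace_zero : Lp := Lclass 0.
Definition Lspace_opp (x : Lp) : Lp := Lclass (- Lrepr x).
Definition Lspace_add (x y : Lp) : Lp := Lclass (Lrepr x + Lrepr y).
Definition Lspace_scale (a : R) (x : Lp) : Lp := Lclass (a *: Lrepr x).
Definition Lspace_norm (x : Lp) : R := fine 'N[mu]_p[EFin \o Lrepr x]%E.

Lemma Lclass_opp f : Lspace_opp (Lclass f) = Lclass (- f).
Proof.
apply/LclassP; apply: filterS (LclassK f) => x /(_ I) fx _.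
by rewrite -[LHS]/(- (Lrepr (Lclass f) x)) fx.
Qed.

Lemma Lclass_add f g : Lspace_add (Lclass f) (Lclass g) = Lclass (f + g).
Proof.
apply/LclassP; apply: filterS2 (LclassK f) (LclassK g) => x /(_ I) fx /(_ I) gx _.
by rewrite -[LHS]/(Lrepr (Lclass f) x + Lrepr (Lclass g) x) fx gx.
Qed.

Lemma Lclass_scale a f : Lspace_scale a (Lclass f) = Lclass (a *: f).
Proof.
apply/LclassP; apply: filterS (LclassK f) => x /(_ I) fx _.
by rewrite -[LHS]/(a * Lrepr (Lclass f) x) fx.
Qed.

Lemma Lclass_norm f : Lspace_norm (Lclass f) = fine 'N[mu]_p[EFin \o f]%E.
Proof.
congr fine; apply: ae_eq_Lnorm; [exact: measurable_funPT..|exact: LclassK].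
Qed.


Lemma Lspace_addA : associative Lspace_add.
Proof.
move=> x y z; rewrite -[x]LreprK -[y]LreprK -[z]LreprK.
by rewrite !Lclass_add addrA.
Qed.

Lemma Lspace_addC : commutative Lspace_add.
Proof. by move=> x y; rewrite /Lspace_add addrC. Qed.

Lemma Lspace_add0 : left_id Lspace_zero Lspace_add.
Proof. by move=> x; rewrite -[x]LreprK Lclass_add add0r. Qed.

Lemma Lspace_addN : left_inverse Lspace_zero Lspace_opp Lspace_add.
Proof. by move=> x; rewrite -[x]LreprK Lclass_opp Lclass_add addNr. Qed.

HB.instance Definition _ :=
  GRing.isZmodule.Build Lp Lspace_addA Lspace_addC Lspace_add0 Lspace_addN.

Lemma Lspace_scaleA a b (x : Lp) :
  Lspace_scale a (Lspace_scale b x) = Lspace_scale (a * b) x.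
Proof. by rewrite -[x]LreprK !Lclass_scale scalerA. Qed.

Lemma Lspace_scale1 : left_id 1 Lspace_scale.
Proof. by move=> x; rewrite -[x]LreprK Lclass_scale scale1r. Qed.

Lemma Lspace_scaleDr : right_distributive Lspace_scale +%R.
Proof.
move=> a x y; rewrite -[x]LreprK -[y]LreprK.
by rewrite -[X in Lspace_scale a X]/(Lspace_add _ _) Lclass_add !Lclass_scale
  -[RHS]/(Lspace_add _ _) Lclass_add scalerDr.
Qed.

Lemma Lspace_scaleDl (x : Lp) :
  {morph Lspace_scale^~ x : a b / a + b >-> a + b}.
Proof.
move=> a b; rewrite -[x]LreprK !Lclass_scale -[RHS]/(Lspace_add _ _).
by rewrite Lclass_add scalerDl.
Qed.

HB.instance Definition _ := GRing.Zmodule_isLmodule.Build R Lp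
  Lspace_scaleA Lspace_scale1 Lspace_scaleDr Lspace_scaleDl.

Lemma LclassD f g : Lclass (f + g) = Lclass f + Lclass g.
Proof. by rewrite -Lclass_add. Qed.

Lemma LclassZ a f : Lclass (a *: f) = a *: Lclass f.
Proof. by rewrite -Lclass_scale. Qed.

Lemma Lspace_normD x y : Lspace_norm (x + y) <= Lspace_norm x + Lspace_norm y.
Proof.
rewrite -[x]LreprK -[y]LreprK -LclassD !Lclass_norm; exact: ler_LnormD.
Qed.

Lemma Lspace_normZ a x : Lspace_norm (a *: x) = `|a| * Lspace_norm x.
Proof.
rewrite -[x]LreprK -LclassZ !Lclass_norm; apply/EFin_inj.
by rewrite EFinM !finite_norm_fine LnormZ.
Qed.

Lemma Lspace_norm0_eq0 x : Lspace_norm x = 0 -> x = 0.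
Proof.
by rewrite -[x]LreprK Lclass_norm => /fine_Lnormr_eq0 x0; apply/LclassP.
Qed.

HB.instance Definition _ := @Lmodule_isNormed.Build R Lp
  Lspace_norm Lspace_normD Lspace_normZ Lspace_norm0_eq0.

Lemma LspaceNormE (x : Lp) : (`|x|%:E = 'N[mu]_p[EFin \o x])%E.
Proof. exact: (finite_norm_fine (Lrepr x)). Qed.

End Lspace_normed.

Definition pth_power_sum (R : realType) (I : choiceType)
    (E : I -> normedModType R) (p : R) (x : forall i, E i) : \bar R :=
  \esum_(i in [set: I]) (`|x i| `^ p)%:E.

Definition pth_summable (R : realType) (I : choiceType)
    (E : I -> normedModType R) (p : R) (x : forall i, E i) :=
  (pth_power_sum p x < +oo)%E.

(* The l_p-direct sum of the normed spaces [E i]. The proof [p1] is a          *)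
(* parameter so that the normed space structure below can be inferred.         *)
Record lp_sum (R : realType) (I : choiceType) (E : I -> normedModType R)
    (p : R) (p1 : (1 <= p%:E)%E) := LpSum {
  lp_sum_fun :> forall i, E i ;
  lp_sumP : pth_summable p lp_sum_fun }.

Section lp_sum_normed.
Context (R : realType) (I : choiceType) (E : I -> normedModType R).
Variables (p : R) (p1 : (1 <= p%:E)%E).
Implicit Types (x y : forall i, E i) (a t : R).

Local Notation pth_power_sum := (@pth_power_sum R I E p).
Local Notation pth_summable := (@pth_summable R I E p).
Local Notation lp_sum := (@lp_sum R I E p p1).
Local Notation LpSum := (@LpSum R I E p p1 _).

Let p1R : 1 <= p. Proof. by rewrite -lee_fin. Qed.
Let p0 : 0 < p. Proof. exact: lt_le_trans p1R. Qed.
Let pn0 : p != 0. Proof. by rewrite gt_eqF. Qed.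

Lemma pth_power_sum_ge0 x : (0 <= pth_power_sum x)%E.
Proof. by apply: esum_ge0 => i _; rewrite lee_fin powR_ge0. Qed.

Lemma esumZ a (f : I -> \bar R) : 0 <= a -> (forall i, 0 <= f i)%E ->
  (\esum_(i in [set: I]) (a%:E * f i) = a%:E * \esum_(i in [set: I]) f i)%E.
Proof.
move=> a0 f0; rewrite /esum -ereal_supZl//; last first.
  by apply/set0P; exists (\sum_(i \in set0) f i)%E; exists set0 => //; split.
rewrite image_comp; congr ereal_sup; apply: eq_imagel => A _ /=.
by rewrite ge0_mule_fsumr.
Qed.

Lemma pth_power_sumZ a x :
  (pth_power_sum (fun i => a *: x i) = (`|a| `^ p)%:E * pth_power_sum x)%E.
Proof.
rewrite -esumZ ?powR_ge0//.
by apply: eq_esum => i _; rewrite normrZ powRM// EFinM.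
Qed.

Lemma pth_power_sum_convex t x y : 0 <= t <= 1 ->
  (pth_power_sum (fun i => (t *: x i + (1 - t) *: y i)%R) <=
   t%:E * pth_power_sum x + (1 - t)%:E * pth_power_sum y)%E.
Proof.
move=> /andP[t0 t1]; have t1' : 0 <= 1 - t by rewrite subr_ge0.
rewrite -!esumZ//; [|by move=> i; rewrite lee_fin powR_ge0..].
rewrite -esumD; last 2 first.
- by move=> i _; rewrite -EFinM lee_fin mulr_ge0 ?powR_ge0.
- by move=> i _; rewrite -EFinM lee_fin mulr_ge0 ?powR_ge0.
apply: le_esum => i _; rewrite -!EFinM -EFinD lee_fin.
apply: (@le_trans _ _ ((t * `|x i| + (1 - t) * `|y i|) `^ p)).
  rewrite ge0_ler_powR ?nnegrE ?(ltW p0)// ?addr_ge0 ?mulr_ge0//.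
  by rewrite (le_trans (ler_normD _ _))// !normrZ !ger0_norm.
by apply: (convex_powR p1R (Itv01 t0 t1)); rewrite inE/= in_itv/= normr_ge0.
Qed.

Lemma pth_summable0 : pth_summable (fun i => 0 : E i).
Proof.
by rewrite /Defs.pth_summable /Defs.pth_power_sum esum1// => i _; rewrite normr0 powR0.
Qed.

Lemma pth_summableZ a x : pth_summable x -> pth_summable (fun i => a *: x i).
Proof.
by move=> sx; rewrite /Defs.pth_summable pth_power_sumZ lte_mul_pinfty ?lee_fin ?powR_ge0.
Qed.

Lemma pth_summableD x y :
  pth_summable x -> pth_summable y -> pth_summable (fun i => x i + y i).
Proof.
move=> sx sy.
have -> : (fun i => x i + y i) =
    (fun i => 2^-1 *: (2 *: x i) + (1 - 2^-1) *: (2 *: y i)).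
  apply: functional_extensionality_dep => i.
  rewrite (_ : 1 - 2^-1 = 2^-1); last by rewrite {1}(splitr 1) div1r addrK.
  by rewrite !scalerA mulVf// !scale1r.
have h0 : (0 : R) <= 2^-1 by rewrite invr_ge0 ler0n.
have h1 : (2^-1 : R) <= 1 by rewrite invf_le1 ?ler1n.
have h : (0 <= (2^-1 : R) <= 1)%R by apply/andP.
apply: (le_lt_trans (pth_power_sum_convex _ _ h)).
by rewrite lte_add_pinfty// lte_mul_pinfty ?lee_fin ?subr_ge0//; exact: pth_summableZ.
Qed.

Lemma pth_summableN x : pth_summable x -> pth_summable (fun i => - x i).
Proof.
move=> /(pth_summableZ (-1)); congr pth_summable.
by apply: functional_extensionality_dep => i; rewrite scaleN1r.
Qed.

Lemma lp_sum_inj (x y : lp_sum) : (forall i, x i = y i) -> x = y.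
Proof.
case: x y => [x xP] [y yP] /= xyi.
have xy : x = y by exact: functional_extensionality_dep.
by case: _ / xy yP {xyi} => yP; rewrite (Prop_irrelevance xP yP).
Qed.

HB.instance Definition _ := gen_eqMixin lp_sum.
HB.instance Definition _ := gen_choiceMixin lp_sum.

Definition lp_sum_zero := LpSum pth_summable0.
Definition lp_sum_opp (x : lp_sum) := LpSum (pth_summableN (lp_sumP x)).
Definition lp_sum_add (x y : lp_sum) :=
  LpSum (pth_summableD (lp_sumP x) (lp_sumP y)).
Definition lp_sum_scale a (x : lp_sum) := LpSum (pth_summableZ a (lp_sumP x)).
Definition lp_sum_norm (x : lp_sum) : R := fine (pth_power_sum x) `^ p^-1.

Lemma lp_sum_addA : associative lp_sum_add.
Proof. by move=> x y z; apply: lp_sum_inj => i /=; rewrite addrA. Qed.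

Lemma lp_sum_addC : commutative lp_sum_add.
Proof. by move=> x y; apply: lp_sum_inj => i /=; rewrite addrC. Qed.

Lemma lp_sum_add0 : left_id lp_sum_zero lp_sum_add.
Proof. by move=> x; apply: lp_sum_inj => i /=; rewrite add0r. Qed.

Lemma lp_sum_addN : left_inverse lp_sum_zero lp_sum_opp lp_sum_add.
Proof. by move=> x; apply: lp_sum_inj => i /=; rewrite addNr. Qed.

HB.instance Definition _ :=
  GRing.isZmodule.Build lp_sum lp_sum_addA lp_sum_addC lp_sum_add0 lp_sum_addN.

Lemma lp_sum_scaleA a b (x : lp_sum) :
  lp_sum_scale a (lp_sum_scale b x) = lp_sum_scale (a * b) x.
Proof. by apply: lp_sum_inj => i /=; rewrite scalerA. Qed.

Lemma lp_sum_scale1 : left_id 1 lp_sum_scale.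
Proof. by move=> x; apply: lp_sum_inj => i /=; rewrite scale1r. Qed.

Lemma lp_sum_scaleDr : right_distributive lp_sum_scale +%R.
Proof. by move=> a x y; apply: lp_sum_inj => i /=; rewrite scalerDr. Qed.

Lemma lp_sum_scaleDl (x : lp_sum) :
  {morph lp_sum_scale^~ x : a b / a + b >-> a + b}.
Proof. by move=> a b; apply: lp_sum_inj => i /=; rewrite scalerDl. Qed.

HB.instance Definition _ := GRing.Zmodule_isLmodule.Build R lp_sum
  lp_sum_scaleA lp_sum_scale1 lp_sum_scaleDr lp_sum_scaleDl.

Lemma pth_power_sumE (x : lp_sum) :
  (pth_power_sum x = (lp_sum_norm x `^ p)%:E)%E.
Proof.
have xfin : pth_power_sum x \is a fin_num.
  by rewrite ge0_fin_numE ?pth_power_sum_ge0//; exact: lp_sumP.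
by rewrite /lp_sum_norm -powRrM mulVf// powRr1 ?fine_ge0 ?pth_power_sum_ge0// fineK.
Qed.

Lemma lp_sum_norm_ge0 (x : lp_sum) : 0 <= lp_sum_norm x.
Proof. exact: powR_ge0. Qed.

Lemma lp_sum_normZ a (x : lp_sum) : lp_sum_norm (a *: x) = `|a| * lp_sum_norm x.
Proof.
rewrite {1}/lp_sum_norm -[pth_power_sum _]/(pth_power_sum (fun i => a *: x i)).
rewrite pth_power_sumZ pth_power_sumE -EFinM -powRM ?lp_sum_norm_ge0//=.
by rewrite -powRrM mulfV// powRr1// mulr_ge0 ?lp_sum_norm_ge0.
Qed.

Lemma lp_sum_norm0_eq0 (x : lp_sum) : lp_sum_norm x = 0 -> x = 0.
Proof.
move=> x0; apply: lp_sum_inj => i /=; apply/normr0_eq0/(@powR_eq0_eq0 _ _ p).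
apply/eqP; rewrite eq_le powR_ge0 andbT -lee_fin.
have := pth_power_sumE x; rewrite x0 powR0// => <-.
apply: esum_ge; exists [set i]; first by split.
by rewrite fsbig_set1.
Qed.

Lemma lp_sum_normD (x y : lp_sum) :
  lp_sum_norm (x + y) <= lp_sum_norm x + lp_sum_norm y.
Proof.
have [/eqP/lp_sum_norm0_eq0 ->|x0] := boolP (lp_sum_norm x == 0).
  by rewrite add0r lerDr lp_sum_norm_ge0.
have [/eqP/lp_sum_norm0_eq0 ->|y0] := boolP (lp_sum_norm y == 0).
  by rewrite addr0 lerDl lp_sum_norm_ge0.
have {}x0 : 0 < lp_sum_norm x by rewrite lt_neqAle eq_sym x0 lp_sum_norm_ge0.
have {}y0 : 0 < lp_sum_norm y by rewrite lt_neqAle eq_sym y0 lp_sum_norm_ge0.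
move Ea : (lp_sum_norm x) x0 => a x0; move Eb : (lp_sum_norm y) y0 => b y0.
have ab0 : 0 < a + b by exact: addr_gt0.
pose t := a / (a + b).
have t01 : 0 <= t <= 1.
  by rewrite divr_ge0 ?(ltW x0) ?(ltW ab0)//= ler_pdivrMr// mul1r lerDl ltW.
have tE : 1 - t = b / (a + b).
  by rewrite /t -[1](@divff _ (a + b)) ?gt_eqF// -mulrBl addrC addKr.
pose z : lp_sum := t *: (a^-1 *: x) + (1 - t) *: (b^-1 *: y).
have xyE : x + y = (a + b) *: z.
  rewrite /z tE scalerDr !scalerA /t; congr (_ + _).
    by rewrite mulrCA divff ?gt_eqF// mulr1 divff ?gt_eqF// scale1r.
  by rewrite mulrCA divff ?gt_eqF// mulr1 divff ?gt_eqF// scale1r.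
rewrite xyE lp_sum_normZ gtr0_norm// ler_piMr ?(ltW ab0)//.
have : (pth_power_sum z <= 1)%E.
  apply: (le_trans (pth_power_sum_convex (a^-1 *: x) (b^-1 *: y) t01)).
  rewrite !pth_power_sumE !lp_sum_normZ Ea Eb !gtr0_norm ?invr_gt0//.
  by rewrite !mulVf ?gt_eqF// powR1 !mule1 -EFinD addrC subrK.
rewrite pth_power_sumE lee_fin => z1.
rewrite leNgt; apply/negP => z1'; move: z1; rewrite leNgt => /negP; apply.
have : 1 `^ p < lp_sum_norm z `^ p.
  by apply: gt0_ltr_powR; rewrite ?nnegrE ?lp_sum_norm_ge0.
by rewrite powR1.
Qed.

HB.instance Definition _ := @Lmodule_isNormed.Build R lp_sum
  lp_sum_norm lp_sum_normD lp_sum_normZ lp_sum_norm0_eq0.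

End lp_sum_normed.

Definition lp_space (R : realType) (p : R) (p1 : (1 <= p%:E)%E)
    (I : choiceType) := @lp_sum R I (fun=> R^o) p p1.

HB.instance Definition _ (R : realType) (p : R) (p1 : (1 <= p%:E)%E)
  (I : choiceType) := NormedModule.on (lp_space p1 I).

Section subspaces_and_operators.
Context (R : realType).
Implicit Types V W : normedModType R.

Definition closed_subspace V (X : set V) :=
  [/\ closed X, X 0 & forall (a : R) x y, X x -> X y -> X (a *: x + y)].

Definition bounded_linear_on V W (X : set V) (f : V -> W) :=
  (forall (a : R) x y, X x -> X y -> f (a *: x + y) = a *: f x + f y) /\
  (exists M : R, forall x, X x -> `|f x| <= M * `|x|).

Definition isometric_embedding V W (f : {linear V -> W}) :=
  forall v, `|f v| = `|v|.

Definition isomorphic_embedding V W (f : {linear V -> W}) :=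
  exists2 c : R, 0 < c &
    exists C : R, forall v, c * `|v| <= `|f v| /\ `|f v| <= C * `|v|.

Definition isometric V W :=
  exists2 f : {linear V -> W}, isometric_embedding f & range f = [set: W].

Definition embeds_isometrically V W (X : set W) :=
  exists2 f : {linear V -> W}, isometric_embedding f & range f `<=` X.

Definition embeds_isomorphically V W (X : set W) :=
  exists2 f : {linear V -> W}, isomorphic_embedding f & range f `<=` X.

Definition isomorphic_to V W (Y : set W) :=
  exists2 f : {linear V -> W}, isomorphic_embedding f & range f = Y.

Definition complemented V (Y : set V) :=
  exists P : {linear V -> V},
    [/\ bounded_linear_on [set: V] P, forall v, P (P v) = P v & range P = Y].

End subspaces_and_operators.

(* Cardinals are represented by types. *)
Definition card_lt (A B : Type) :=
  ([set: A] #<= [set: B])%card /\ ~ ([set: B] #<= [set: A])%card.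

(* [Y] is an L_p(K)-space. Completeness of [Y] is not required separately: it  *)
(* follows from the isometry, the l_p-sum of the spaces L_p(mu_i) being        *)
(* complete.                                                                   *)
Definition Lp_card_space (R : realType) (p : R) (p1 : (1 <= p%:E)%E)
    (K : Type) (Y : normedModType R) :=
  exists (I : choiceType) (d : I -> measure_display)
    (T : forall i, measurableType (d i))
    (mu : forall i, {finite_measure set (T i) -> \bar R}),
    ([set: I] #<= [set: K])%card /\
    isometric Y (lp_sum (fun i => LspaceType (mu i) p1) p1).

Lemma lee1_gt2 (R : realType) (p : R) : 2 < p -> (1 <= p%:E)%E.
Proof. by move=> p2; rewrite lee_fin (le_trans _ (ltW p2))// ler1n. Qed.

(* Main.v *)
(* (1) -> (2): the equality case of |a + b|^p + |a - b|^p >= 2(|a|^p + |b|^p)   *)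
(* for p > 2 forces isometric images of disjoint vectors to be disjoint, and    *)
(* the span of a disjoint family f_a of unit vectors is the range of the        *)
(* projection v |-> sum_a (int v f_a |f_a|^(p-2)) f_a.                          *)
(* (3) -> (4): an operator from l_p(A) into L_p of a finite measure, hence into *)
(* L_2, maps all but countably many unit vectors to 0, since sums of m signed   *)
(* unit vectors have norm m^(1/p) while their images may have L_2-norm of order *)
(* m^(1/2). So an injection into the l_p-sum of K such spaces gives A <= K.     *)
(* (4) -> (1): take a maximal disjoint family G of nonzero elements of X. If    *)
(* A <= G, then G spans an isometric copy of l_p(A). Otherwise restricting to   *)
(* the annuli {1/(n+1) <= |g| < 1/n}, g in G, which have finite measure, is     *)
(* injective on X by maximality, and there are |G| aleph_0 < |A| of them.       *)
From HB Require Import structures.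
Require Import Defs.
From mathcomp Require Import all_boot all_order all_algebra.
From mathcomp Require Import all_classical all_reals all_analysis.
From mathcomp Require Import finmap measurable_realfun ring lra.
Import Order.TTheory GRing.Theory Num.Theory.
Import numFieldNormedType.Exports.
Local Open Scope classical_set_scope.
Local Open Scope ring_scope.
Set Implicit Arguments.
Unset Strict Implicit.
Unset Printing Implicit Defensive.

(** For p > 2 the inequality |a + b|^p + |a - b|^p >= 2(|a|^p + |b|^p) is strict unless ab = 0, so
    L_p norms detect disjointness ([Ldisjoint_of_norm_powR]). An isometric copy of l_p(A) is
    therefore spanned by disjoint unit vectors f_a, and the functionals of [norming_functional],
    each living on the support of one f_a, assemble into a contractive projection onto the copy
    ([isometric_complemented]). In the other direction, disjoint unit vectors of X indexed by A span
    an isometric copy of l_p(A) inside X ([disjoint_family_embeds]).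

    Whether X has such a family is a matter of counting. Take a maximal disjoint family G of nonzero
    elements of X. If A <= |G|, normalise. If not, maximality says that no nonzero element of X
    vanishes on the supports of all members of G; these supports split into |G| aleph_0 annuli of
    finite measure, and restriction to the annuli injects X into an l_p-sum of too few L_p spaces of
    finite measures ([maximal_family_injection]), which (4) forbids.

    Such an injection cannot coexist with an isomorphic copy of l_p(A). On a finite measure L_p lies
    in the Hilbert space L_2, where suitably signed sums of m vectors bounded below have norm of
    order at least m^(1/2), while signed sums of m unit vectors of l_p(A) have norm m^(1/p). So each
    coordinate of a bounded operator is large on finitely many unit vectors only
    ([finite_sqint_ge]), and A would be covered by |K| aleph_0 = |K| finite sets
    ([card_le_lp_sum]). *)

(** * Comparing cardinals of types *)

Lemma card_leT_injP (X Y : Type) :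
  ([set: X] #<= [set: Y])%card <-> exists f : X -> Y, injective f.
Proof.
split=> [/card_leP[f]|[f fI]].
  exists (fun x => set_val (f (SigSub (mem_set (I : [set: X] x))))).
  by move=> x y /val_inj e; have /(congr1 val) := inj (in_setT _) (in_setT _) e.
have : $|{injfun [set: X] >-> [set: Y]}|.
  by apply/injfunPex; exists f => // x y _ _ /fI.
by case=> g; exact: inj_card_le g.
Qed.

(** Zorn's lemma in the form shared by matchings, families of sequences and families of functions.
    As [disj] need not be symmetric, maximality speaks of both orders. *)
Lemma maximal_disjoint (T : Type) (disj : T -> T -> Prop) (P : set T) :
  exists G : set T, [/\ G `<=` P,
    forall x y, G x -> G y -> x <> y -> disj x y &
    forall z, P z -> ~ G z -> exists2 x, G x & ~ (disj x z /\ disj z x)].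
Proof.
pose Q := [set G : set T | G `<=` P /\
  forall x y, G x -> G y -> x <> y -> disj x y].
have [F FQ Ftot|G [[GP Gd] Gmax]] := @Zorn_bigcup T Q.
  split=> [x [G FG Gx]|x y [G FG Gx] [H FH Hy]]; first exact: (FQ _ FG).1.
  by have [GH|HG] := Ftot _ _ FG FH;
    [apply: (FQ _ FH).2 => //; exact: GH|apply: (FQ _ FG).2 => //; exact: HG].
exists G; split=> // z Pz nGz; apply: contrapT => nex.
have Gz x : G x -> disj x z /\ disj z x.
  by move=> Gx; apply: contrapT => nd; apply: nex; exists x.
apply: (Gmax (z |` G)).
  split; first by move=> x Gx; right.
  by move=> /(_ z (or_introl erefl)).
split=> [x [->//|/GP//]|x y [->|Gx] [->|Gy] xy //].
- exact: (Gz _ Gy).2.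
- exact: (Gz _ Gx).1.
- exact: Gd.
Qed.

(** A maximal partial matching, seen as a set of pairs any two of which differ in both coordinates,
    exhausts one of the two types; otherwise two unmatched elements could be paired. *)
Lemma card_leT_total (X Y : Type) :
  ([set: X] #<= [set: Y])%card \/ ([set: Y] #<= [set: X])%card.
Proof.
pose compat (u v : X * Y) := u.1 <> v.1 /\ u.2 <> v.2.
have [G [_ Gd Gmax]] := maximal_disjoint compat setT.
have [tot|/existsNP[x nx]] := pselect (forall x, exists y, G (x, y)).
  left; apply/card_leT_injP; have [f fG] := choice tot.
  exists f => x x' ff; apply: contrapT => xx'.
  by have [] := Gd _ _ (fG x) (fG x') (fun e => xx' (congr1 fst e)).
have [tot|/existsNP[y ny]] := pselect (forall y, exists x, G (x, y)).
  right; apply/card_leT_injP; have [f fG] := choice tot.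
  exists f => y y' ff; apply: contrapT => yy'.
  by have [] := Gd _ _ (fG y) (fG y') (fun e => yy' (congr1 snd e)).
have [[x' y'] Gxy []] := Gmax (x, y) I (fun g => nx (ex_intro _ y g)).
suff [xx yy] : x' <> x /\ y' <> y by split; split=> //= /esym.
by split=> e; [apply: nx; exists y'|apply: ny; exists x']; rewrite -e.
Qed.

(* A maximal family of countably infinite subsets of [K] with disjoint ranges  *)
(* exhausts [K] up to a finite set, which is absorbed by one of its members.   *)
Lemma card_leT_Xnat (K : Type) : infinite_set [set: K] ->
  ([set: K * nat] #<= [set: K])%card.
Proof.
move=> Koo.
pose disjoint (f g : nat -> K) := forall m n, f m <> g n.
have [J [Jinj Jd Jmax]] := maximal_disjoint disjoint [set f : nat -> K | injective f].
pose rest := [set k : K | forall f n, J f -> f n <> k].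
have restfin : finite_set rest.
  apply: contrapT => /infiniteP/card_leP[g].
  pose h n := set_val (g (SigSub (mem_set (I : [set: nat] n)))).
  have hinj : injective h.
    by move=> m n /val_inj e; have /(congr1 val) := inj (in_setT _) (in_setT _) e.
  have hrest n : rest (h n) by apply: set_mem; exact: valP.
  have [|f Jf []] := Jmax h hinj.
    by move=> Jh; exact: (hrest 0%N h 0%N Jh erefl).
  by split=> m n; [exact: hrest|move=> e; exact: (hrest m f n Jf)].
have [f0 Jf0] : exists f0, J f0.
  apply: contrapT => nJ; apply: Koo.
  apply: sub_finite_set restfin => k _ f n Jf; exfalso; apply: nJ.
  by exists f.
have [rk rkinj] : exists rk : K -> nat, {in rest &, injective rk}.
  exact/countable_injP/finite_set_countable.
(* Flag [true]: k is the n-th value of a member f of J. Flag [false]: k is in the finite remainder,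
   attached to [f0] with its rank. *)
have /choice[code codeP] k : exists u : (nat -> K) * nat * bool,
    J u.1.1 /\ if u.2 then u.1.1 u.1.2 = k else rest k /\ u.1.2 = rk k.
  have [[f [n [Jf <-]]]|nk] := pselect (exists f n, J f /\ f n = k).
    by exists (f, n, true).
  exists (f0, rk k, false) => /=; split=> //; split=> // f n Jf fn.
  by apply: nk; exists f, n.
have code_inj k l : code k = code l -> k = l.
  move=> kl; have := codeP k; have := codeP l; rewrite -kl.
  case: (code k) => -[f n] [] /=; first by move=> [_ ->] [_ ->].
  by move=> [_ [rl nl]] [_ [rk' nk]]; apply: rkinj;
    [exact: mem_set|exact: mem_set|rewrite -nk].
apply/card_leT_injP.
(* The pair (k, m) is sent along the sequence f of k, to the index that codes n, the flag and m.
   Disjoint ranges recover f, and injectivity of f recovers the index. *)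
exists (fun u : K * nat => (code u.1).1.1 (choice.pickle ((code u.1).1.2, (code u.1).2, u.2))).
move=> [k m] [l n] /= e.
have [Jk _] := codeP k; have [Jl _] := codeP l.
have kl : (code k).1.1 = (code l).1.1.
  by apply: contrapT => /(Jd _ _ Jk Jl)/(_ _ _ e).
move: e; rewrite kl => /(Jinj _ Jl)/(pcan_inj choice.pickleK) [e1 e2 ->].
congr pair; apply: code_inj; move: kl e1 e2.
by case: (code k) => -[? ?] ?; case: (code l) => -[? ?] ? /= -> -> ->.
Qed.

(** * Powers, integrals and representatives in L_p *)

Lemma powR_le_cancel (R : realType) (p x y : R) : 0 < p -> 0 <= x -> 0 <= y ->
  x `^ p <= y `^ p -> x <= y.
Proof.
move=> p0 x0 y0; apply: contraTT; rewrite -!ltNge => yx.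
by apply: gt0_ltr_powR; rewrite ?nnegrE.
Qed.

Lemma ge0_integralD_EFin d (T : measurableType d) (R : realType)
    (nu : {measure set T -> \bar R}) (f g : T -> R) :
  (forall t, 0 <= f t) -> (forall t, 0 <= g t) ->
  measurable_fun [set: T] f -> measurable_fun [set: T] g ->
  (\int[nu]_t (f t + g t)%:E = \int[nu]_t (f t)%:E + \int[nu]_t (g t)%:E)%E.
Proof.
move=> f0 g0 mf mg; rewrite -ge0_integralD//.
- by move=> t _; rewrite lee_fin.
- exact/measurable_EFinP.
- by move=> t _; rewrite lee_fin.
- exact/measurable_EFinP.
Qed.

Section Lspace_representatives.
Context d (T : measurableType d) (R : realType).
Variables (nu : {measure set T -> \bar R}) (p : R) (p1 : (1 <= p%:E)%E).
Local Notation Lp := (LspaceType nu p1).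
Implicit Types (x y z : Lp) (a b : R).

Lemma exponent_gt0 : 0 < p.
Proof. by move: p1; rewrite lee_fin; exact: lt_le_trans. Qed.
Let p_gt0 := exponent_gt0.
Let p_neq0 : p != 0. Proof. by rewrite gt_eqF. Qed.

Lemma measurable_Lrepr x : measurable_fun [set: T] (Lrepr x).
Proof. exact: measurable_funPT. Qed.

Lemma measurable_powR_norm (f : T -> R) (r : R) : measurable_fun [set: T] f ->
  measurable_fun [set: T] (fun t => (`|f t| `^ r)%:E).
Proof.
move=> mf; apply/measurable_EFinP/(@measurableT_comp _ _ _ _ _ _ (@powR R ^~ r)) => //.
exact: measurableT_comp.
Qed.

Lemma measurable_powR_Lrepr x (r : R) :
  measurable_fun [set: T] (fun t => (`|Lrepr x t| `^ r)%:E).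
Proof. exact/measurable_powR_norm/measurable_Lrepr. Qed.

Lemma Lspace_norm_powR x :
  ((`|x| `^ p)%:E = \int[nu]_t (`|Lrepr x t| `^ p)%:E)%E.
Proof. by rewrite -poweR_EFin LspaceNormE poweR_Lnorm. Qed.

Lemma Lspace_exists (f : T -> R) : measurable_fun [set: T] f ->
  (\int[nu]_t (`|f t| `^ p)%:E < +oo)%E ->
  exists x : Lp, {ae nu, forall t, Lrepr x t = f t}.
Proof.
move=> mf ff; have fL : f \in Lfun nu p%:E.
  rewrite inE/=; apply/andP; split; first exact: mem_set.
  by apply: mem_set; rewrite /finite_norm unlock /= poweR_lty.
exists (Lclass (Lfun_Sub p1 fL)).
by apply: filterS (LclassK (Lfun_Sub p1 fL)) => t /(_ I).
Qed.

Lemma Lspace_eqP x y : x = y <-> {ae nu, forall t, Lrepr x t = Lrepr y t}.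
Proof.
split=> [->|xy]; first exact: nearW.
rewrite -[x]LreprK -[y]LreprK; apply/LclassP.
by apply: filterS xy => t.
Qed.

Lemma LreprD x y : {ae nu, forall t, Lrepr (x + y) t = Lrepr x t + Lrepr y t}.
Proof. by apply: filterS (LclassK (Lrepr x + Lrepr y)) => t /(_ I). Qed.

Lemma LreprZ a x : {ae nu, forall t, Lrepr (a *: x) t = a * Lrepr x t}.
Proof. by apply: filterS (LclassK (a *: Lrepr x)) => t /(_ I). Qed.

Lemma LreprB x y : {ae nu, forall t, Lrepr (x - y) t = Lrepr x t - Lrepr y t}.
Proof.
apply: filterS2 (LreprD x (-1 *: y)) (LreprZ (-1) y) => t.
by rewrite scaleN1r => -> ->; rewrite mulN1r.
Qed.

Lemma Lrepr0 : {ae nu, forall t, Lrepr (0 : Lp) t = 0}.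
Proof. by apply: filterS (LreprZ 0 0) => t; rewrite scale0r mul0r. Qed.

Lemma Lspace_eq0P x : x = 0 <-> {ae nu, forall t, Lrepr x t = 0}.
Proof.
rewrite Lspace_eqP; split; apply: filterS2 Lrepr0 => t; by [move=> -> -> | move=> ->].
Qed.

End Lspace_representatives.

(** * Disjoint elements of L_p *)

Section disjointness.
Context d (T : measurableType d) (R : realType).
Variables (nu : {measure set T -> \bar R}) (p : R) (p1 : (1 <= p%:E)%E).
Local Notation Lp := (LspaceType nu p1).
Implicit Types (x y z : Lp) (a b : R).
Let p_gt0 := exponent_gt0 p1.

Definition Ldisjoint x y := {ae nu, forall t, Lrepr x t * Lrepr y t = 0}.

Lemma LdisjointC x y : Ldisjoint x y -> Ldisjoint y x.
Proof. by apply: filterS => t; rewrite mulrC. Qed.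

Lemma Ldisjointxx x : Ldisjoint x x -> x = 0.
Proof.
move=> xx; apply/Lspace_eq0P; apply: filterS xx => t /eqP.
by rewrite mulf_eq0 orbb => /eqP.
Qed.

Lemma Ldisjoint0 x : Ldisjoint x 0.
Proof. by apply: filterS (Lrepr0 nu p1) => t ->; rewrite mulr0. Qed.

Lemma LdisjointZr a x y : Ldisjoint x y -> Ldisjoint x (a *: y).
Proof.
move=> xy; apply: filterS2 xy (LreprZ a y) => t xyt ->.
by rewrite mulrCA xyt mulr0.
Qed.

Lemma LdisjointDr x y z : Ldisjoint x y -> Ldisjoint x z -> Ldisjoint x (y + z).
Proof.
move=> xy xz; apply: filterS3 xy xz (LreprD y z) => t xyt xzt ->.
by rewrite mulrDr xyt xzt addr0.
Qed.

Lemma Ldisjoint_sumr (I : Type) (s : seq I) (P : pred I) (F : I -> Lp) x :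
  (forall i, P i -> Ldisjoint x (F i)) -> Ldisjoint x (\sum_(i <- s | P i) F i).
Proof.
move=> xF; elim/big_rec: _ => [|i y Pi xy]; first exact: Ldisjoint0.
by apply: LdisjointDr => //; exact: xF.
Qed.

Lemma Ldisjoint_norm_powRD x y : Ldisjoint x y ->
  `|x + y| `^ p = `|x| `^ p + `|y| `^ p.
Proof.
move=> xy; apply: EFin_inj; rewrite EFinD !Lspace_norm_powR.
rewrite -ge0_integralD//; [|exact: measurable_powR_Lrepr..].
apply: ge0_ae_eq_integral => //.
- exact: measurable_powR_Lrepr.
- by apply: emeasurable_funD; exact: measurable_powR_Lrepr.
- by move=> t _; rewrite -EFinD lee_fin addr_ge0.
apply: filterS2 xy (LreprD x y) => t /eqP + -> _.
rewrite mulf_eq0 => /orP[] /eqP ->.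
  by rewrite add0r normr0 powR0 ?gt_eqF// add0e.
by rewrite addr0 normr0 powR0 ?gt_eqF// adde0.
Qed.

Lemma Ldisjoint_norm_powR_sum (I : eqType) (s : seq I) (F : I -> Lp) : uniq s ->
  {in s &, forall i j, i != j -> Ldisjoint (F i) (F j)} ->
  `|\sum_(i <- s) F i| `^ p = \sum_(i <- s) `|F i| `^ p.
Proof.
elim: s => [|i s IH] /=.
  by rewrite !big_nil normr0 powR0// gt_eqF.
move=> /andP[iNs us] dF; rewrite !big_cons Ldisjoint_norm_powRD.
  rewrite IH// => j k js ks; apply: dF; by rewrite in_cons ?js ?ks orbT.
rewrite big_seq; apply: Ldisjoint_sumr => j js.
apply: dF; rewrite ?in_cons ?eqxx ?js ?orbT//.
by apply: contraNneq iNs => ->.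
Qed.

End disjointness.

(** * Detecting disjointness by norms when p > 2 *)

(** Write u^r as u * u^(r-1): in s(s+t)^(r-1) + t(s+t)^(r-1) both powers of s+t exceed those of s
    and t, strictly when s and t are positive. *)
Lemma powR_superadditive (R : realType) (r s t : R) : 1 < r -> 0 <= s -> 0 <= t ->
  s `^ r + t `^ r <= (s + t) `^ r ?= iff (s * t == 0).
Proof.
move=> r1 s0 t0; have r0 : 0 < r := lt_trans ltr01 r1.
have r10 : 0 < r - 1 by rewrite subr_gt0.
have [->|sn0] := eqVneq s 0.
  by rewrite mul0r eqxx add0r powR0 ?gt_eqF// add0r; apply/leif_refl.
have [->|tn0] := eqVneq t 0.
  by rewrite mulr0 eqxx addr0 powR0 ?gt_eqF// addr0; apply/leif_refl.
rewrite mulf_eq0 (negPf sn0) (negPf tn0) /=; apply/leifP => /=.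
have {}s0 : 0 < s by rewrite lt_def sn0.
have {}t0 : 0 < t by rewrite lt_def tn0.
have st0 := addr_gt0 s0 t0.
rewrite -[s `^ r]mulr_powRB1 ?ltW// -[t `^ r]mulr_powRB1 ?ltW//.
rewrite -[X in _ < X]mulr_powRB1 ?(ltW st0)// mulrDl ltrD// ltr_pM2l//.
  by apply: gt0_ltr_powR; rewrite ?nnegrE ?(ltW s0) ?(ltW st0)// ltrDl.
by apply: gt0_ltr_powR; rewrite ?nnegrE ?(ltW t0) ?(ltW st0)// ltrDr.
Qed.

Lemma powR_midpoint (R : realType) (r s t : R) : 1 <= r -> 0 <= s -> 0 <= t ->
  2 * ((s + t) / 2) `^ r <= s `^ r + t `^ r.
Proof.
move=> r1 s0 t0.
have h0 : (0 : R) <= 2^-1 by rewrite invr_ge0.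
have h1 : (2^-1 : R) <= 1 by rewrite invf_le1 ?ler1n.
have half : 1 - 2^-1 = 2^-1 :> R by field.
have sI : s \in (`[0, +oo[%classic : set R) by apply: mem_set; rewrite /= in_itv/= s0.
have tI : t \in (`[0, +oo[%classic : set R) by apply: mem_set; rewrite /= in_itv/= t0.
have : (2^-1 * s + (1 - 2^-1) * t) `^ r <= 2^-1 * s `^ r + (1 - 2^-1) * t `^ r.
  exact: (convex_powR r1 (Itv01 h0 h1) sI tI).
rewrite half -!mulrDr [2^-1 * (s + t)]mulrC => H.
by rewrite -ler_pdivlMl ?ltr0n.
Qed.

(* Convexity of [u |-> u^(p/2)] applied to [(a + b)^2] and [(a - b)^2], then   *)
(* its strict superadditivity applied to [a^2] and [b^2].                      *)
Lemma powR_norm_parallelogram (R : realType) (p a b : R) : 2 < p ->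
  2 * (`|a| `^ p + `|b| `^ p) <= `|a + b| `^ p + `|a - b| `^ p /\
  (2 * (`|a| `^ p + `|b| `^ p) = `|a + b| `^ p + `|a - b| `^ p -> a * b = 0).
Proof.
move=> p2; pose r := p / 2.
have r1 : 1 < r by rewrite /r ltr_pdivlMr// mul1r.
have powE c : `|c| `^ p = (c ^+ 2) `^ r.
  have -> : p = 2 * r by rewrite /r; field.
  by rewrite powRrM (powR_mulrn 2)// real_normK// num_real.
rewrite !powE.
have := powR_midpoint (ltW r1) (sqr_ge0 (a + b)) (sqr_ge0 (a - b)).
have -> : ((a + b) ^+ 2 + (a - b) ^+ 2) / 2 = a ^+ 2 + b ^+ 2 by field.
have [le_sup eq_sup] := powR_superadditive r1 (sqr_ge0 a) (sqr_ge0 b).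
move=> le_mid; split; first lra.
move=> e; have : a ^+ 2 * b ^+ 2 == 0 by rewrite -eq_sup; apply/eqP; lra.
by rewrite -exprMn expf_eq0 /= => /eqP.
Qed.

Section Lamperti.
Context d (T : measurableType d) (R : realType).
Variables (nu : {measure set T -> \bar R}) (p : R) (p1 : (1 <= p%:E)%E).
Local Notation Lp := (LspaceType nu p1).
Implicit Types (x y z : Lp) (a b : R).
Hypothesis p_gt2 : 2 < p.

(** The hypothesis is the integrated form of [powR_norm_parallelogram] with equality. The
    non-negative difference of the two sides thus vanishes almost everywhere, and the pointwise case
    of equality applies. *)
Lemma Ldisjoint_of_norm_powR x y :
  `|x + y| `^ p + `|x - y| `^ p = 2 * (`|x| `^ p + `|y| `^ p) -> Ldisjoint x y.
Proof.
move=> xyE.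
pose N (z : Lp) t := `|Lrepr z t| `^ p.
pose S t := N x t + N x t + (N y t + N y t).
pose D t := `|Lrepr x t + Lrepr y t| `^ p + `|Lrepr x t - Lrepr y t| `^ p.
have mN z : measurable_fun [set: T] (N z).
  by apply/measurable_EFinP; exact: measurable_powR_Lrepr.
have mS : measurable_fun [set: T] S by do ! apply: measurable_funD.
have mD : measurable_fun [set: T] D.
  apply: measurable_funD; apply/measurable_EFinP/measurable_powR_norm.
    by apply: measurable_funD; exact: measurable_Lrepr.
  by apply: measurable_funB; exact: measurable_Lrepr.
have N0 z t : 0 <= N z t by exact: powR_ge0.
have SD t : S t <= D t.
  have [+ _] := powR_norm_parallelogram (Lrepr x t) (Lrepr y t) p_gt2.
  by apply: le_trans; rewrite /S /N; lra.
have S0 t : 0 <= S t by rewrite !addr_ge0.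
have intN z : (\int[nu]_t (N z t)%:E = (`|z| `^ p)%:E)%E.
  by rewrite Lspace_norm_powR.
have intS : (\int[nu]_t (S t)%:E = (2 * (`|x| `^ p + `|y| `^ p))%:E)%E.
  rewrite !ge0_integralD_EFin//; [|by move=> t; rewrite addr_ge0|by move=> t; rewrite addr_ge0
    |exact: measurable_funD|exact: measurable_funD].
  by rewrite !intN -!EFinD; congr EFin; ring.
have intDE : (\int[nu]_t (D t)%:E = (2 * (`|x| `^ p + `|y| `^ p))%:E)%E.
  rewrite -xyE EFinD -!intN -ge0_integralD_EFin//.
  apply: ge0_ae_eq_integral => //.
  - exact/measurable_EFinP.
  - by apply/measurable_EFinP; exact: measurable_funD.
  - by move=> t _; rewrite lee_fin addr_ge0.
  - by move=> t _; rewrite lee_fin addr_ge0.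
  - by apply: filterS2 (LreprD x y) (LreprB x y) => t e1 e2 _; rewrite /N e1 e2.
pose h t := D t - S t.
have mh : measurable_fun [set: T] h by exact: measurable_funB.
have h0 t : 0 <= h t by rewrite subr_ge0.
have inth : (\int[nu]_t `|(h t)%:E| = 0)%E.
  under eq_integral do rewrite gee0_abs ?lee_fin//.
  have : (\int[nu]_t (S t + h t)%:E = \int[nu]_t (D t)%:E)%E.
    by apply: eq_integral => t _; rewrite /h addrC subrK.
  rewrite ge0_integralD_EFin// intDE intS.
  (* The integrals of S and D are the same finite number, which can be cancelled. *)
  move=> /(congr1 (fun e => e - (2 * (`|x| `^ p + `|y| `^ p))%:E)%E).
  by rewrite addeAC subee// add0e.
have /ae_eq_integral_abs : measurable_fun [set: T] (EFin \o h).
  exact/measurable_EFinP.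
move=> /(_ nu measurableT)[/(_ inth) + _]; apply: filterS => t /(_ I) [].
have [_ +] := powR_norm_parallelogram (Lrepr x t) (Lrepr y t) p_gt2.
by move=> + ht; apply; move: ht; rewrite /h /D /S /N; lra.
Qed.

End Lamperti.

(** * Disjoint supports and norming functionals *)

Lemma ae_all_seq d (T : measurableType d) (R : realType)
    (nu : {measure set T -> \bar R}) (I : eqType) (s : seq I)
    (P : I -> T -> Prop) : {in s, forall i, {ae nu, forall t, P i t}} ->
  {ae nu, forall t, {in s, forall i, P i t}}.
Proof.
elim: s => [|i s IH] Ps; first exact: nearW.
have Pi : {ae nu, forall t, P i t} by apply: Ps; rewrite mem_head.
have {}IH : {ae nu, forall t, {in s, forall i, P i t}}.
  by apply: IH => j js; apply: Ps; rewrite in_cons js orbT.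
apply: filterS2 Pi IH => t Pit IHt j.
by rewrite in_cons => /predU1P[->//|/IHt].
Qed.

Section disjoint_sets.
Context d (T : measurableType d) (R : realType).
Variables (nu : {measure set T -> \bar R}) (p : R) (p1 : (1 <= p%:E)%E).
Local Notation Lp := (LspaceType nu p1).

(** Almost everywhere at most one of the indicators is 1. The family is finite so that the
    exceptional null sets can be united; this suffices, as norms in an l_p-sum are suprema over
    finite sets. *)
Lemma sum_integral_ae_disjoint (I : eqType) (s : seq I) (B : I -> set T) (v : Lp) :
  uniq s -> (forall i, measurable (B i)) ->
  {in s &, forall i j, i != j -> {ae nu, forall t, ~ (B i t /\ B j t)}} ->
  (\sum_(i <- s) \int[nu]_t (\1_(B i) t * `|Lrepr v t| `^ p)%:E <= (`|v| `^ p)%:E)%E.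
Proof.
move=> us mB dB.
have mf i : measurable_fun [set: T] (fun t => (\1_(B i) t * `|Lrepr v t| `^ p)%:E).
  apply/measurable_EFinP/measurable_funM; first exact: measurable_indic.
  by apply/measurable_EFinP; exact: measurable_powR_Lrepr.
have f0 i t : (0 <= (\1_(B i) t * `|Lrepr v t| `^ p)%:E)%E.
  by rewrite lee_fin mulr_ge0// powR_ge0.
rewrite -ge0_integral_sum// Lspace_norm_powR; apply: ae_ge0_le_integral => //.
- by move=> t _; apply: sume_ge0.
- exact: emeasurable_sum.
- exact: measurable_powR_Lrepr.
have : {ae nu, forall t, {in s, forall i, {in s, forall j, i != j -> ~ (B i t /\ B j t)}}}.
  apply: ae_all_seq => i si; apply: ae_all_seq => j sj.
  have [->|ij] := eqVneq i j; first exact: nearW.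
  by apply: filterS (dB i j si sj ij) => t + _.
apply: filterS => t dt _; rewrite sumEFin lee_fin -mulr_suml.
rewrite ler_piMl ?powR_ge0//.
elim: s us dt {dB} => [|i s IH] /=; first by rewrite big_nil.
move=> /andP[iNs us] dt; rewrite big_cons indicE.
have [/set_mem Bi|nBi] := boolP (t \in B i); last first.
  rewrite add0r IH// => j js k ks; apply: dt; by rewrite in_cons ?js ?ks orbT.
rewrite big1_seq ?addr0// => j /= js; rewrite indicE memNset// => Bj.
have ij : i != j by apply: contraNneq iNs => ->.
by apply: (dt i _ j _ ij); rewrite ?in_cons ?eqxx ?js ?orbT.
Qed.

End disjoint_sets.

Section norming_functional.
Context d (T : measurableType d) (R : realType).
Variables (nu : {measure set T -> \bar R}) (p : R) (p1 : (1 <= p%:E)%E).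
Local Notation Lp := (LspaceType nu p1).
Hypothesis p_gt2 : 2 < p.

Definition Lsupport (f : Lp) := [set t | Lrepr f t != 0].

Lemma measurable_Lsupport f : measurable (Lsupport f).
Proof.
have := measurable_Lrepr f measurableT (measurableC (measurable_set1 (0 : R))).
rewrite setTI; congr measurable; apply/seteqP; split=> t /=; first by move/eqP.
by move=> /eqP.
Qed.

Lemma Ldisjoint_supportP f g : Ldisjoint f g <->
  {ae nu, forall t, ~ (Lsupport f t /\ Lsupport g t)}.
Proof.
rewrite /Lsupport; split; apply: filterS => t /=.
  by move=> /eqP; rewrite mulf_eq0 => /orP[] -> [].
move=> fg; apply/eqP; rewrite mulf_eq0.
by apply: contrapT => /negP; rewrite negb_or => /andP.
Qed.

(** The functional is v |-> int v f |f|^(p-2), whose density has norm 1 in the conjugate space. As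
    the density vanishes off the support of f, Hölder's inequality may be applied to v cut down to
    that support; this local bound can be summed over disjoint f. *)
Lemma norming_functional (f : Lp) : `|f| = 1 -> exists phi : Lp -> R,
  [/\ forall a x y, phi (a *: x + y) = a * phi x + phi y, phi f = 1,
      forall v, Ldisjoint f v -> phi v = 0 &
      forall v, ((`|phi v| `^ p)%:E <=
        \int[nu]_t (\1_(Lsupport f) t * `|Lrepr v t| `^ p)%:E)%E].
Proof.
move=> f1.
have p0 : 0 < p := exponent_gt0 p1.
have p10 : 0 < p - 1 by rewrite subr_gt0 (lt_trans _ p_gt2)// ltr1n.
(* The exponent p - 2 is written so that the rule |x| |x|^(r-1) = |x|^r applies with r = p - 1 and
   then with r = p. *)
pose g t := Lrepr f t * `|Lrepr f t| `^ (p - 1 - 1).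
have mg : measurable_fun [set: T] g.
  apply: measurable_funM; first exact: measurable_Lrepr.
  by apply/measurable_EFinP; exact: measurable_powR_Lrepr.
have normg t : `|g t| = `|Lrepr f t| `^ (p - 1).
  by rewrite normrM [X in _ * X]ger0_norm ?powR_ge0// mulr_powRB1.
pose B := Lsupport f.
have mB : measurable B := measurable_Lsupport f.
pose q := p / (p - 1).
have q0 : 0 < q by rewrite divr_gt0.
have pq : p^-1 + q^-1 = 1 by rewrite /q; field; rewrite !gt_eqF.
have normgq : ('N[nu]_q%:E[EFin \o g] = 1)%E.
  rewrite unlock /=; under eq_integral do rewrite normg -powRrM.
  have -> : (p - 1) * q = p by rewrite /q; field; rewrite gt_eqF.
  by rewrite -Lspace_norm_powR f1 poweR_EFin !powR1.
pose vB (v : Lp) t := \1_B t * Lrepr v t.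
have mvB v : measurable_fun [set: T] (vB v).
  by apply: measurable_funM; [exact: measurable_indic|exact: measurable_Lrepr].
have vBg v t : vB v t * g t = Lrepr v t * g t.
  rewrite /vB indicE; have [|/negP nBt] := boolP (t \in B); first by rewrite mul1r.
  suff -> : g t = 0 by rewrite !mulr0.
  rewrite /g; have [->|ft] := eqVneq (Lrepr f t) 0; first by rewrite mul0r.
  by exfalso; apply: nBt; apply: mem_set.
have powvB v : (('N[nu]_p%:E[EFin \o vB v] `^ p)%E =
    \int[nu]_t (\1_B t * `|Lrepr v t| `^ p)%:E)%E.
  rewrite poweR_Lnorm ?gt_eqF//; apply: eq_integral => t _ /=.
  rewrite /vB normrM indicE.
  case: (t \in B); first by rewrite normr1 !mul1r.
  by rewrite normr0 !mul0r powR0// gt_eqF.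
have hold v : (\int[nu]_t `|(Lrepr v t * g t)%:E| <= 'N[nu]_p%:E[EFin \o vB v])%E.
  have := hoelder nu (mvB v) mg p0 q0 pq.
  rewrite normgq mule1 Lnorm1; congr (_ <= _)%E.
  by apply: eq_integral => t _ /=; rewrite vBg.
have finvB v : ('N[nu]_p%:E[EFin \o vB v] < +oo)%E.
  apply: (@lty_poweRy _ _ p); first by rewrite gt_eqF.
  rewrite powvB; apply: (@le_lt_trans _ _ (`|v| `^ p)%:E); last exact: ltry.
  rewrite Lspace_norm_powR; apply: ge0_le_integral => //.
  - apply/measurable_EFinP/measurable_funM; first exact: measurable_indic.
    by apply/measurable_EFinP; exact: measurable_powR_Lrepr.
  - exact: measurable_powR_Lrepr.
  - by move=> t _; rewrite lee_fin ler_piMl ?powR_ge0// indicE lern1 leq_b1.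
have mvg (v : Lp) : measurable_fun [set: T] (EFin \o (fun t => Lrepr v t * g t)).
  by apply/measurable_EFinP/measurable_funM => //; exact: measurable_Lrepr.
have ivg (v : Lp) : nu.-integrable [set: T] (EFin \o (fun t => Lrepr v t * g t)).
  by apply/integrableP; split=> //; apply: le_lt_trans (hold v) (finvB v).
exists (fun v => \int[nu]_t (Lrepr v t * g t)); split.
- move=> a x y; rewrite -RintegralZl// -RintegralD//; last first.
    have := integrableZl measurableT a (ivg x).
    by congr (integrable _ _ _); apply/funext => t /=.
  congr fine; apply: ae_eq_integral => //.
    exact: mvg.
    apply/measurable_EFinP/measurable_funD; last exact/measurable_EFinP/mvg.
    by apply: measurable_funM => //; apply/measurable_EFinP; exact: mvg.
  apply: filterS2 (LreprD (a *: x) y) (LreprZ a x) => t -> -> _.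
  by rewrite mulrDl mulrA.
- have -> : \int[nu]_t (Lrepr f t * g t) = fine (\int[nu]_t (`|Lrepr f t| `^ p)%:E)%E.
    congr fine; apply: eq_integral => t _; congr EFin.
    rewrite /g mulrA -expr2 -real_normK ?num_real// expr2 -mulrA.
    by rewrite mulr_powRB1// mulr_powRB1.
  by rewrite -Lspace_norm_powR f1 powR1.
- move=> v fv; have -> : \int[nu]_t (Lrepr v t * g t) = fine (\int[nu]_t (cst 0 t))%E.
    congr fine; apply: ae_eq_integral => //; first exact: mvg.
    apply: filterS fv => t fvt _; congr EFin.
    by rewrite /g mulrA [_ * Lrepr f t]mulrC fvt mul0r.
  by rewrite integral0.
- move=> v; rewrite -powvB -poweR_EFin; apply: gt0_ler_poweR; first exact: ltW.
  + by rewrite in_itv/= leey lee_fin normr_ge0.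
  + by rewrite in_itv/= leey Lnorm_ge0.
  apply: le_trans (hold v); rewrite -abse_EFin /Rintegral fineK.
    by apply: le_abse_integral => //; exact: mvg.
  exact: (integrable_fin_num measurableT (ivg v)).
Qed.

End norming_functional.

(** * Closed sets, norms of l_p-sums and unit vectors *)

Lemma closed_approxP (R : realType) (V : normedModType R) (X : set V) :
  closed X <->
  forall v, (forall e, 0 < e -> exists2 x, X x & `|v - x| < e) -> X v.
Proof.
split=> [Xcl v vX|XP v vX].
  apply: Xcl => B /nbhs_ballP[e /= e0 eB].
  have [x Xx vx] := vX e e0.
  by exists x; split=> //; apply: eB; rewrite -ball_normE.
apply: XP => e e0.
have [x [Xx]] := vX _ (nbhsx_ballx v e e0).
by rewrite -ball_normE; exists x.
Qed.

Section lp_sum_norm.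
Context (R : realType) (I : choiceType) (E : I -> normedModType R).
Variables (p : R) (p1 : (1 <= p%:E)%E).

Lemma pth_power_sum_le (x : forall i, E i) (M : R) :
  (forall F : {fset I}, \sum_(i <- F) `|x i| `^ p <= M) ->
  (pth_power_sum p x <= M%:E)%E.
Proof.
move=> xM; apply: ge_ereal_sup => _ [F [Ffin _] <-].
by rewrite fsbig_finite//= sumEFin lee_fin.
Qed.

Lemma lp_sum_norm_powRE (x : lp_sum E p1) : ((`|x| `^ p)%:E = pth_power_sum p x)%E.
Proof. by rewrite pth_power_sumE. Qed.

Lemma lp_sum_norm_ge (x : lp_sum E p1) (F : {fset I}) :
  \sum_(i <- F) `|x i| `^ p <= `|x| `^ p.
Proof.
rewrite -lee_fin lp_sum_norm_powRE; apply: esum_ge.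
exists [set` F]; first by split=> //; exact: finite_fset.
by rewrite fsbig_finite// set_fsetK sumEFin.
Qed.

Lemma lp_sum_norm_approx (x : lp_sum E p1) (e : R) : 0 < e ->
  exists F : {fset I}, `|x| `^ p - e < \sum_(i <- F) `|x i| `^ p.
Proof.
move=> e0; apply: contrapT => /forallNP nF.
suff : (pth_power_sum p x <= (`|x| `^ p - e)%:E)%E.
  by rewrite -lp_sum_norm_powRE lee_fin lerBrDr gerDl leNgt e0.
by apply: pth_power_sum_le => F; rewrite leNgt; apply/negP/nF.
Qed.

End lp_sum_norm.

Section lp_unit.
Context (R : realType) (A : choiceType) (p : R) (p1 : (1 <= p%:E)%E).
Local Notation lp := (lp_space p1 A).
Let p_gt0 := exponent_gt0 p1.
Let p_neq0 : p != 0. Proof. by rewrite gt_eqF. Qed.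

Let unit_fun (a b : A) : R^o := (b == a)%:R.

Lemma pth_power_sum_unit (c : R) a :
  (\esum_(b in [set: A]) (`|c * unit_fun a b| `^ p)%:E = (`|c| `^ p)%:E)%E.
Proof.
transitivity (\esum_(b in [set a]) (`|c * unit_fun a b| `^ p)%:E)%E.
  rewrite [RHS]esum_mkcond; apply: eq_esum => b _; rewrite /unit_fun.
  have [->|ba] := eqVneq b a; first by rewrite mem_set.
  by rewrite mulr0 normr0 powR0// memNset//= => /eqP; exact/negP.
by rewrite esum_set1 /unit_fun ?eqxx ?mulr1// lee_fin powR_ge0.
Qed.

Lemma pth_summable_unit a : pth_summable (E := fun=> R^o) p (unit_fun a).
Proof.
rewrite /pth_summable /pth_power_sum.
have := pth_power_sum_unit 1 a; under eq_esum do rewrite mul1r.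
by move=> ->; exact: ltry.
Qed.

Definition lp_unit a : lp := LpSum p1 (pth_summable_unit a).

Lemma lp_norm_powRE (z : lp) :
  ((`|z| `^ p)%:E = \esum_(b in [set: A]) (`|z b| `^ p)%:E)%E.
Proof. exact: (@lp_sum_norm_powRE R A (fun=> R^o) p p1 z). Qed.

Lemma lp_norm_unitD (c : R) a (z : lp) : z a = 0 ->
  `|c *: lp_unit a + z| `^ p = `|c| `^ p + `|z| `^ p.
Proof.
move=> za; apply: EFin_inj; apply: etrans (lp_norm_powRE _) _.
apply: etrans (esym (EFinD _ _)).
have zE := lp_norm_powRE z.
transitivity (\esum_(b in [set: A]) (`|c * unit_fun a b| `^ p)%:E +
  \esum_(b in [set: A]) (`|z b| `^ p)%:E)%E; last first.
  by congr (_ + _)%E; [exact: pth_power_sum_unit|exact: esym zE].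
rewrite -esumD; last 2 first.
- by move=> b _; rewrite lee_fin powR_ge0.
- by move=> b _; rewrite lee_fin powR_ge0.
apply: eq_esum => b _ /=; rewrite -EFinD; congr EFin.
rewrite -[c *: _]/(c * unit_fun a b) /unit_fun.
have [->|ba] := eqVneq b a; first by rewrite za normr0 powR0// !addr0.
by rewrite mulr0 normr0 powR0// !add0r.
Qed.

Lemma lp_norm_unit1D a (z : lp) : z a = 0 ->
  `|lp_unit a + z| `^ p = 1 + `|z| `^ p.
Proof.
move=> za; have N1 : `|1 : R| `^ p = 1 by rewrite normr1 powR1.
have E1 := congr1 (fun u => `|u + z| `^ p) (scale1r (lp_unit a)).
exact: etrans (esym E1) (etrans (lp_norm_unitD 1 za) (congr1 (+%R^~ _) N1)).
Qed.

Lemma lp_norm_unit a : `|lp_unit a| = 1.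
Proof.
have := @lp_norm_unitD 1 a 0 erefl.
rewrite scale1r addr0 !normr0 powR0// addr0 normr1 powR1 => /eqP.
by rewrite powR_eq1 (negPf p_neq0) ltNge normr_ge0 !orbF => /eqP.
Qed.

Lemma lp_unit_id a : lp_unit a a = 1.
Proof. by rewrite /= /unit_fun eqxx. Qed.

Lemma lp_sub_unit (z : lp) a : (z - z a *: lp_unit a) a = 0.
Proof.
rewrite -[LHS]/(z a - z a * lp_unit a a).
by rewrite lp_unit_id mulr1 subrr.
Qed.

Lemma lp_unit_neq a b : a != b -> lp_unit b a = 0.
Proof. by rewrite /= /unit_fun => /negPf->. Qed.

End lp_unit.

(** * Isometric copies of l_p(A) are complemented *)

Section isometric_image.
Context d (T : measurableType d) (R : realType).
Variables (nu : {measure set T -> \bar R}) (p : R) (p1 : (1 <= p%:E)%E).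
Local Notation Lp := (LspaceType nu p1).
Context (A : choiceType).
Local Notation lp := (lp_space p1 A).
Local Notation e := (lp_unit p1).
Hypothesis p_gt2 : 2 < p.
Variable U : {linear lp -> Lp}.
Hypothesis U_isometric : isometric_embedding U.

(** Both e_a + z and e_a - z have p-th power of the norm 1 + |z|^p. [U] preserves these values, so
    its images are in the case of equality that forces disjointness. *)
Lemma isometric_Ldisjoint a (z : lp) : z a = 0 -> Ldisjoint (U (e a)) (U z).
Proof.
move=> za; apply: (Ldisjoint_of_norm_powR p_gt2).
have H (w : lp) : w a = 0 -> `|U (e a) + U w| `^ p = 1 + `|U w| `^ p.
  move=> wa; have -> : `|U (e a) + U w| = `|e a + w| by rewrite -raddfD U_isometric.
  by rewrite (U_isometric w); exact: lp_norm_unit1D.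
have nza : (- z) a = 0 by rewrite -[LHS]/(- (z a)) za oppr0.
have := H _ nza; rewrite raddfN normrN => ->; rewrite (H _ za).
have -> : `|U (e a)| = 1 by rewrite U_isometric; exact: lp_norm_unit.
by rewrite powR1; ring.
Qed.

(** The norming functionals of the disjoint vectors U(e_a) form a contraction c into l_p(A) that is
    a left inverse of [U]. Hence [U \o c] is a contractive projection, and its range is closed as
    the set of its fixed points. *)
Lemma isometric_complemented : closed_subspace (range U) /\ complemented (range U).
Proof.
have p0 := exponent_gt0 p1.
have normU a : `|U (e a)| = 1 by rewrite U_isometric lp_norm_unit.
have [phi phiP] := choice (fun a => norming_functional p_gt2 (normU a)).
have sum_phi v (F : {fset A}) : \sum_(a <- F) `|phi a v| `^ p <= `|v| `^ p.
  rewrite -lee_fin -sumEFin.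
  apply: (@le_trans _ _ (\sum_(a <- F)
      \int[nu]_t (\1_(Lsupport (U (e a))) t * `|Lrepr v t| `^ p)%:E)%E).
    by apply: lee_sum => a _; have [_ _ _] := phiP a; exact.
  apply: sum_integral_ae_disjoint => [|a|a b _ _ ab]; first exact: fset_uniq.
    exact: measurable_Lsupport.
  by apply/Ldisjoint_supportP/isometric_Ldisjoint; rewrite lp_unit_neq.
have phi_summable v : pth_summable (E := fun=> R^o) p (fun a => phi a v).
  by apply: (le_lt_trans (pth_power_sum_le (sum_phi v))); exact: ltry.
pose c v : lp := LpSum p1 (phi_summable v).
have normc v : `|c v| <= `|v|.
  have : `|c v| `^ p <= `|v| `^ p.
    by rewrite -lee_fin lp_sum_norm_powRE; exact: pth_power_sum_le (sum_phi v).
  exact: powR_le_cancel.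
have cU z : c (U z) = z.
  apply: lp_sum_inj => a /=; have [phiD phi1 phi0 _] := phiP a.
  pose w := z - z a *: e a.
  (* Since w vanishes at a, U w is disjoint from U(e_a) and is killed by the functional of a. *)
  have -> : U z = z a *: U (e a) + U w by rewrite -linearP /w addrC subrK.
  rewrite phiD phi1 phi0; first by rewrite mulr1 addr0.
  by apply: isometric_Ldisjoint; exact: lp_sub_unit.
have clin : linear c.
  by move=> k x y; apply: lp_sum_inj => a /=; have [phiD _ _ _] := phiP a.
pose Plin : {linear Lp -> Lp} := HB.pack (U \o c)
  (GRing.isLinear.Build R Lp Lp *:%R (U \o c)
    (fun k x y => etrans (congr1 U (clin k x y)) (linearP U k _ _))).
have Pbound v : `|Plin v| <= `|v| by rewrite /= U_isometric.
have rangeP : range Plin = range U.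
  apply/seteqP; split=> _ [v _ <-]; first by exists (c v).
  by exists (U v) => //=; rewrite cU.
have PU v : range U v -> Plin v = v by move=> [z _ <-] /=; rewrite cU.
split; last first.
  exists Plin; split.
  - split=> [k x y _ _|]; first exact: linearP.
    by exists 1 => v _; rewrite mul1r; exact: Pbound.
  - by move=> v; apply: PU; exists (c v).
  - exact: rangeP.
split.
- apply/closed_approxP => v vU.
  suff vP : v = Plin v by rewrite -rangeP vP; exists v.
  apply/eqP; rewrite -subr_eq0 -normr_le0; apply/ler_addgt0Pl => r r0.
  have [y Uy vy] := vU (r / 2) (divr_gt0 r0 (ltr0Sn R 1)).
  (* y is fixed by the projection, so |v - P v| <= 2|v - y|, hence the choice of r / 2. *)
  have -> : v - Plin v = (v - y) - Plin (v - y).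
    have -> : Plin (v - y) = Plin v - y by rewrite -[in RHS](PU _ Uy) -raddfB.
    by rewrite opprB addrA subrK.
  rewrite addr0 (le_trans (ler_normB _ _))// [leRHS]splitr lerD// ?ltW//.
  exact: le_lt_trans (Pbound _) vy.
- by exists 0 => //; rewrite raddf0.
- by move=> k _ _ [x _ <-] [y _ <-]; exists (k *: x + y) => //; rewrite linearP.
Qed.

End isometric_image.

(** * Operators from l_p(A) into L_p of a finite measure *)

Section square_integral.
Context d (T : measurableType d) (R : realType).
Variables (mu : {finite_measure set T -> \bar R}) (p : R) (p1 : (1 <= p%:E)%E).
Local Notation Lp := (LspaceType mu p1).
Implicit Types (u v : Lp).
Hypothesis p_gt2 : 2 < p.

(** The squared L_2 norm; [fine] loses nothing, by [sqintE]. *)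
Definition sqint u : R := fine (\int[mu]_t (Lrepr u t ^+ 2)%:E)%E.

Lemma measurable_sqr_Lrepr u : measurable_fun [set: T] (fun t => (Lrepr u t ^+ 2)%:E).
Proof. by apply/measurable_EFinP/measurable_funX; exact: measurable_Lrepr. Qed.

(** Pointwise s^2 <= 1 + |s|^p, and the constant 1 has finite integral. *)
Lemma integral_sqr_le u :
  (\int[mu]_t (Lrepr u t ^+ 2)%:E <= (fine (mu [set: T]) + `|u| `^ p)%:E)%E.
Proof.
have -> : ((fine (mu [set: T]) + `|u| `^ p)%:E =
    \int[mu]_t (cst 1 t + (`|Lrepr u t| `^ p)%:E))%E.
  rewrite ge0_integralD//; last exact: measurable_powR_Lrepr.
  rewrite integral_cst// mul1e EFinD Lspace_norm_powR fineK//.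
  exact: fin_num_measure.
apply: ge0_le_integral => //.
- by move=> t _; rewrite lee_fin sqr_ge0.
- exact: measurable_sqr_Lrepr.
- by apply: emeasurable_funD => //; exact: measurable_powR_Lrepr.
move=> t _; rewrite -EFinD lee_fin -real_normK ?num_real//.
have [t1|t1] := leP `|Lrepr u t| 1.
  by rewrite (@le_trans _ _ 1) ?expr_le1// lerDl powR_ge0.
by rewrite -(powR_mulrn 2)// (le_trans (ler_powR (ltW t1) (ltW p_gt2)))// lerDr.
Qed.

Lemma sqintE u : ((sqint u)%:E = \int[mu]_t (Lrepr u t ^+ 2)%:E)%E.
Proof.
rewrite fineK// ge0_fin_numE; last first.
  by apply: integral_ge0 => t _; rewrite lee_fin sqr_ge0.
by apply: le_lt_trans (integral_sqr_le u) _; exact: ltry.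
Qed.

Lemma sqint_le u : sqint u <= fine (mu [set: T]) + `|u| `^ p.
Proof. by rewrite -lee_fin sqintE integral_sqr_le. Qed.

Lemma sqint_ge0 u : 0 <= sqint u.
Proof. by apply: fine_ge0; apply: integral_ge0 => t _; rewrite lee_fin sqr_ge0. Qed.

Lemma sqint_parallelogram u v :
  sqint (u + v) + sqint (u - v) = 2 * (sqint u + sqint v).
Proof.
pose Q (w : Lp) t := Lrepr w t ^+ 2.
have mQ (w : Lp) : measurable_fun [set: T] (Q w).
  by apply/measurable_EFinP; exact: measurable_sqr_Lrepr.
have Q0 (w : Lp) t : 0 <= Q w t by exact: sqr_ge0.
have mS (w w' : Lp) : measurable_fun [set: T] (fun t => Q w t + Q w' t).
  by apply: measurable_funD; exact: mQ.
have S0 (w w' : Lp) t : 0 <= Q w t + Q w' t by rewrite addr_ge0.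
have sqintD (w w' : Lp) : ((sqint w + sqint w')%:E = \int[mu]_t (Q w t + Q w' t)%:E)%E.
  by rewrite EFinD !sqintE -(ge0_integralD_EFin _ (Q0 w) (Q0 w') (mQ w) (mQ w')).
apply: EFin_inj.
have -> : 2 * (sqint u + sqint v) = (sqint u + sqint u) + (sqint v + sqint v).
  by ring.
rewrite sqintD EFinD !sqintD.
rewrite -(ge0_integralD_EFin _ (S0 u u) (S0 v v) (mS u u) (mS v v)).
apply: ge0_ae_eq_integral => //.
- by apply/measurable_EFinP/measurable_funD; exact: mQ.
- by apply/measurable_EFinP; do ! apply: measurable_funD; exact: mQ.
- by move=> t _; rewrite lee_fin addr_ge0 ?sqr_ge0.
- by move=> t _; rewrite lee_fin !addr_ge0 ?sqr_ge0.
apply: filterS2 (LreprD u v) (LreprB u v) => t e1 e2 _.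
by congr EFin; rewrite /Q e1 e2; ring.
Qed.

Lemma sqintZ c u : sqint (c *: u) = c ^+ 2 * sqint u.
Proof.
apply: EFin_inj; rewrite EFinM !sqintE -ge0_integralZl//.
- apply: ge0_ae_eq_integral => //.
  + exact: measurable_sqr_Lrepr.
  + by apply: measurable_funeM; exact: measurable_sqr_Lrepr.
  + by move=> t _; rewrite lee_fin sqr_ge0.
  + by move=> t _; rewrite -EFinM lee_fin mulr_ge0 ?sqr_ge0.
  by apply: filterS (LreprZ c u) => t -> _; rewrite exprMn EFinM.
- exact: measurable_sqr_Lrepr.
- by move=> t _; rewrite lee_fin sqr_ge0.
- by rewrite lee_fin sqr_ge0.
Qed.

Lemma sqint_gt0 u : u <> 0 -> 0 < sqint u.
Proof.
move=> u0; rewrite lt_def sqint_ge0 andbT; apply/eqP => q0; apply: u0.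
apply/Lspace_eq0P.
have /ae_eq_integral_abs := measurable_sqr_Lrepr u.
move=> /(_ mu measurableT)[+ _].
under eq_integral do rewrite gee0_abs ?lee_fin ?sqr_ge0//.
rewrite -sqintE q0 => /(_ erefl); apply: filterS => t /(_ I) [] /eqP.
by rewrite expf_eq0 /= => /eqP.
Qed.

Context (A : choiceType).
Local Notation lp := (lp_space p1 A).
Local Notation e := (lp_unit p1).
Variables (S : lp -> Lp) (M : R).
Hypothesis S_linear : linear S.
Hypothesis S_bounded : forall z, `|S z| <= M * `|z|.

(* By the parallelogram law one of the two signs [+-e a] can be added without  *)
(* decreasing the square integral.                                             *)
Lemma signed_sum_sqint (s : seq A) : uniq s -> exists z : lp,
  [/\ `|z| `^ p = (size s)%:R, \sum_(a <- s) sqint (S (e a)) <= sqint (S z) &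
      forall b, b \notin s -> z b = 0].
Proof.
elim: s => [_|a s IH /= /andP[aNs us]].
  exists 0; split=> //; last by rewrite big_nil sqint_ge0.
  by rewrite normr0 powR0// gt_eqF// (exponent_gt0 p1).
have [z [zn zq z0]] := IH us.
have za := z0 a aNs.
have sgnP c : `|c| = 1 -> sqint (S (e a)) + sqint (S z) <= sqint (S (c *: e a + z)) ->
    exists z : lp, [/\ `|z| `^ p = (size s).+1%:R,
    \sum_(b <- a :: s) sqint (S (e b)) <= sqint (S z) &
    forall b, b \notin a :: s -> z b = 0].
  move=> c1 cq; exists (c *: e a + z); split.
  - by rewrite lp_norm_unitD// c1 powR1 zn -natr1 addrC.
  - by rewrite big_cons (le_trans _ cq)// lerD2l.
  - move=> b; rewrite in_cons negb_or => /andP[ba bs].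
    rewrite -[LHS]/(c * e a b + z b) z0// lp_unit_neq ?mulr0 ?addr0//.
have := sqint_parallelogram (S z) (S (e a)).
have [le1 _|lt1 par] := leP (sqint (S (e a)) + sqint (S z)) (sqint (S z + S (e a))).
  by apply: (sgnP 1); rewrite ?normr1// S_linear scale1r addrC in le1 *.
apply: (sgnP (-1)); first by rewrite normrN1.
by rewrite S_linear scaleN1r [- _ + _]addrC; lra.
Qed.

(* With [z] a signed sum of [m] unit vectors, [m delta <= sqint (S z)] while   *)
(* [sqint (S z)] is of order at most [|z|^2 = m^(2/p)].                        *)
Lemma finite_sqint_ge (delta : R) : 0 < delta ->
  finite_set [set a | delta <= sqint (S (e a))].
Proof.
move=> delta0; apply: contrapT => Foo.
have p0 : 0 < p := exponent_gt0 p1.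
pose C := fine (mu [set: T]) + M `^ p.
(* If |z|^p = m then m / |z|^2 = m^s, and s > 0 because p > 2. *)
pose s := 1 - 2 / p.
have s0 : 0 < s by rewrite subr_gt0 ltr_pdivrMr ?mul1r.
(* Chosen so that m >= n gives m^s delta > C, whereas C bounds the square integral of the image of z
   / |z|. *)
pose n := (Num.truncn ((C / delta) `^ s^-1)).+1.
have [B BF nB] := infinite_set_fset n Foo.
have [z [zn zq _]] := signed_sum_sqint (fset_uniq B).
pose m := size B; rewrite -/m in zn.
have m0 : 0 < (m%:R : R) by rewrite ltr0n; exact: leq_trans nB.
have z0 : 0 < `|z|.
  by rewrite (@gt0_powR _ `|z| p)// zn.
have zE : `|z|^-1 ^+ 2 = m%:R `^ s / m%:R.
  have zp0 : 0 < `|z| `^ p by rewrite powR_gt0.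
  rewrite -zn -powRrM; have -> : p * s = p - 2 by rewrite /s; field; rewrite gt_eqF.
  rewrite powRB; last by rewrite (gt_eqF z0) implybT.
  by rewrite (powR_mulrn 2)//; field; rewrite !gt_eqF.
have M0 : 0 <= M.
  by have := le_trans (normr_ge0 _) (S_bounded z); rewrite pmulr_lge0.
have : sqint (S (`|z|^-1 *: z + 0)) <= C.
  apply: le_trans (sqint_le _) _; rewrite lerD2l ge0_ler_powR ?nnegrE ?(ltW p0)//.
  rewrite (le_trans (S_bounded _))// addr0 normrZ normfV normr_id mulVf ?mulr1//.
  by rewrite gt_eqF.
have S0 : S 0 = 0.
  by have := S_linear (-1) 0 0; rewrite scaler0 addr0 scaleN1r addNr.
rewrite S_linear S0 addr0 sqintZ zE; apply/negP; rewrite -ltNge.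
apply: (@lt_le_trans _ _ (m%:R `^ s / m%:R * (m%:R * delta))); last first.
  rewrite ler_pM2l ?divr_gt0 ?powR_gt0// (le_trans _ zq)//.
  have -> : m%:R * delta = \sum_(a <- B) delta.
    by rewrite big_const_seq count_predT iter_addr_0 mulr_natl.
  by rewrite big_seq [leRHS]big_seq; apply: ler_sum => a /BF.
rewrite mulrA divfK ?gt_eqF// -ltr_pdivrMr//.
have [C0|C0] := leP (C / delta) 0; first by rewrite (le_lt_trans C0)// powR_gt0.
have -> : C / delta = ((C / delta) `^ s^-1) `^ s.
  by rewrite -powRrM mulVf ?gt_eqF// powRr1// ltW.
apply: gt0_ltr_powR; rewrite ?nnegrE ?powR_ge0//.
apply: lt_le_trans (truncnS_gt _) _; by rewrite ler_nat.
Qed.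

End square_integral.

(** * Operators into l_p-sums and the cardinal bound *)

Lemma lp_sum_coord_le (R : realType) (I : choiceType) (E : I -> normedModType R)
    (p : R) (p1 : (1 <= p%:E)%E) (x : lp_sum E p1) i : `|x i| <= `|x|.
Proof.
apply: (powR_le_cancel (exponent_gt0 p1)) => //.
by have := lp_sum_norm_ge x [fset i]%fset; rewrite big_seq_fset1.
Qed.

Lemma card_le_finite_fibers (A B K : Type) (f : A -> B) :
  infinite_set [set: K] -> ([set: B] #<= [set: K])%card ->
  (forall b, finite_set (f @^-1` [set b])) -> ([set: A] #<= [set: K])%card.
Proof.
move=> Koo /card_leT_injP[g ginj] ffin; apply: card_le_trans (card_leT_Xnat Koo).
have /choice[rk rkP] b : exists rk : A -> nat, {in f @^-1` [set b] &, injective rk}.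
  exact/countable_injP/finite_set_countable.
apply/card_leT_injP; exists (fun a => (g (f a), rk (f a) a)).
move=> a b [/ginj fab]; rewrite fab; apply: rkP; exact: mem_set.
Qed.

Section coordinates.
Context (R : realType) (p : R) (p1 : (1 <= p%:E)%E) (A I : choiceType).
Context (d : I -> measure_display) (T : forall i, measurableType (d i)).
Variable mu : forall i, {finite_measure set (T i) -> \bar R}.
Local Notation lp := (lp_space p1 A).
Local Notation sum_Lp := (lp_sum (fun i => LspaceType (mu i) p1) p1).
Hypothesis p_gt2 : 2 < p.

(** Each S(e_a) has a nonzero coordinate i, with square integral at least 1/(m+1) for some m. By
    [finite_sqint_ge] for the i-th coordinate of [S], the map from a to (i, m) has finite fibres,
    and its target has at most |K| elements. *)
Lemma card_le_lp_sum (K : Type) (S : lp -> sum_Lp) (M : R) :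
  infinite_set [set: K] -> ([set: I] #<= [set: K])%card ->
  linear S -> (forall z, `|S z| <= M * `|z|) -> (forall a, S (lp_unit p1 a) <> 0) ->
  ([set: A] #<= [set: K])%card.
Proof.
move=> Koo IK Slin SM S0.
pose q i (z : lp) := sqint (S z i).
have /choice[f fP] a : exists im : I * nat,
    im.2.+1%:R^-1 <= q im.1 (lp_unit p1 a).
  have [i Si] : exists i, S (lp_unit p1 a) i <> 0.
    apply: contrapT => /forallNP Si; apply/(S0 a)/lp_sum_inj => i.
    by apply: contrapT; exact: Si.
  have q0 : 0 < q i (lp_unit p1 a) by exact: sqint_gt0.
  pose r := (q i (lp_unit p1 a))^-1.
  exists (i, Num.truncn r) => /=; rewrite -[leRHS]invrK lef_pV2 ?posrE ?invr_gt0//.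
  by rewrite ltW ?truncnS_gt.
have INK : ([set: I * nat] #<= [set: K])%card.
  have /card_leT_injP[g ginj] := IK.
  apply: card_le_trans (card_leT_Xnat Koo); apply/card_leT_injP.
  by exists (fun u => (g u.1, u.2)) => -[i m] [j n] [/ginj -> ->].
apply: (card_le_finite_fibers (f := f) Koo INK) => -[i m].
have Si_lin : linear (fun z => S z i) by move=> k x y; rewrite Slin.
have Si_bnd z : `|S z i| <= M * `|z| := le_trans (lp_sum_coord_le (S z) i) (SM z).
have m0 : 0 < m.+1%:R^-1 :> R by rewrite invr_gt0.
apply: sub_finite_set (finite_sqint_ge p_gt2 Si_lin Si_bnd m0) => a /= fa.
by have := fP a; rewrite fa.
Qed.

End coordinates.

Section no_injection.
Context d (T : measurableType d) (R : realType).
Variables (nu : {measure set T -> \bar R}) (p : R) (p1 : (1 <= p%:E)%E).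
Local Notation Lp := (LspaceType nu p1).
Hypothesis p_gt2 : 2 < p.

(** The embedding of l_p(A), the injection on [X] and the isometry onto the l_p-sum compose to a
    bounded operator that kills no unit vector. *)
Lemma isomorphic_no_injection (A : choiceType) (X : set Lp) (K : Type)
    (Z : normedModType R) (f : Lp -> Z) :
  closed_subspace X -> embeds_isomorphically (lp_space p1 A) X ->
  infinite_set [set: K] -> ~ ([set: A] #<= [set: K])%card -> Lp_card_space p1 K Z ->
  bounded_linear_on X f -> ~ set_inj X f.
Proof.
move=> [_ X0 XD] [U [c c0 [C UC]] UX] Koo nAK.
move=> [I [d' [T' [mu [IK [g giso _]]]]]] [flin [M fM]] finj; apply: nAK.
have XU z : X (U z) by apply: UX; exists z.
have f0 : f 0 = 0.
  have := flin 1 0 0 X0 X0; rewrite scaler0 scale1r addr0.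
  by move/(congr1 (fun u => u - f 0)); rewrite addrK subrr.
pose S z := g (f (U z)).
apply: (@card_le_lp_sum R p p1 A I d' T' mu p_gt2 K S (`|M| * C) Koo IK).
- by move=> k x y; rewrite /S linearP flin// linearP.
- move=> z; rewrite /S giso -mulrA.
  apply: le_trans (fM _ (XU z)) _; apply: (@le_trans _ _ (`|M| * `|U z|)).
    by rewrite ler_wpM2r// ler_norm.
  by rewrite ler_wpM2l//; have [_] := UC z.
move=> a Sa; have : U (lp_unit p1 a) = 0.
  apply: finj; [exact: mem_set|exact: mem_set|rewrite f0].
  by apply/normr0_eq0; rewrite -giso; move: Sa; rewrite /S => ->; rewrite normr0.
move=> Ua; have [+ _] := UC (lp_unit p1 a).
have -> := lp_norm_unit p1 a.
by rewrite Ua normr0 mulr1 leNgt c0.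
Qed.

End no_injection.

(** * Convergence of series of disjoint functions *)

Section disjoint_series.
Context d (T : measurableType d) (R : realType).
Variables (nu : {measure set T -> \bar R}) (p : R) (p1 : (1 <= p%:E)%E).
Local Notation Lp := (LspaceType nu p1).
Let p_gt0 := exponent_gt0 p1.

(** The limit is taken pointwise, where it exists trivially, and Fatou's lemma carries the bounds
    over to it. *)
Lemma eventually_constant_limit (y : nat -> Lp) (eps : nat -> R) :
  {ae nu, forall t, exists n0, forall n, (n0 <= n)%N ->
    Lrepr (y n) t = Lrepr (y n0) t} ->
  (forall N n, (N <= n)%N -> `|y n - y N| `^ p <= eps N) ->
  exists z : Lp, forall N, `|z - y N| `^ p <= eps N.
Proof.
move=> [D [mD D0 yD]] yeps.
(* Cutting out the null set D makes the sequences eventually constant everywhere. *)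
pose h n t := \1_(~` D) t * Lrepr (y n) t.
have hcst t : exists n0, forall n, (n0 <= n)%N -> h n t = h n0 t.
  have [Dt|nDt] := pselect (D t).
    exists 0%N => n _; rewrite /h indicE memNset ?mul0r// => nDt; exact: nDt.
  have [n0 n0P] : exists n0, forall n, (n0 <= n)%N -> Lrepr (y n) t = Lrepr (y n0) t.
    by apply: contrapT => nt; apply: nDt; apply: yD.
  by exists n0 => n /n0P; rewrite /h => ->.
have mh n : measurable_fun [set: T] (h n).
  apply: measurable_funM; last exact: measurable_Lrepr.
  by apply: measurable_indic; exact: measurableC.
have /choice[f fP] t : exists r : R, exists n0, forall n, (n0 <= n)%N -> h n t = r.
  by have [n0 hn0] := hcst t; exists (h n0 t), n0.
have mf : measurable_fun [set: T] f.
  apply: (measurable_fun_cvg mh) => t _; apply: cvg_near_cst.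
  by have [n0 hn0] := fP t; exists n0.
have hy n : {ae nu, forall t, h n t = Lrepr (y n) t}.
  exists D; split=> // t /=; apply: contra_notP => nDt.
  by rewrite /h indicE mem_set// mul1r.
have intf N : (\int[nu]_t (`|f t - Lrepr (y N) t| `^ p)%:E <= (eps N)%:E)%E.
  pose g n t := (`|h (n + N)%N t - Lrepr (y N) t| `^ p)%:E.
  have mg n : measurable_fun [set: T] (g n).
    by apply/measurable_powR_norm/measurable_funB => //; exact: measurable_Lrepr.
  have g0 n t : [set: T] t -> (0 <= g n t)%E by rewrite lee_fin powR_ge0.
  have intg n : (\int[nu]_t g n t <= (eps N)%:E)%E.
    rewrite (_ : integral _ _ _ = (`|y (n + N)%N - y N| `^ p)%:E).
      by rewrite lee_fin yeps// leq_addl.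
    rewrite Lspace_norm_powR; apply: ge0_ae_eq_integral => //.
      exact: measurable_powR_Lrepr.
      by move=> t _; rewrite lee_fin powR_ge0.
    apply: filterS2 (hy (n + N)%N) (LreprB (y (n + N)%N) (y N)) => t e1 e2 _.
    by rewrite /g e1 e2.
  have limg t : limn_einf (g ^~ t) = (`|f t - Lrepr (y N) t| `^ p)%:E.
    suff /cvg_limn_einf_sup[] : g ^~ t @ \oo --> (`|f t - Lrepr (y N) t| `^ p)%:E by [].
    have [n0 hn0] := fP t; apply: cvg_near_cst; exists n0 => // n /= n0n.
    by rewrite /g hn0// (leq_trans n0n)// leq_addr.
  under eq_integral do rewrite -limg.
  apply: (le_trans (fatou _ _ _ _)) => //.
  rewrite limn_einf_lim; apply: lime_le; first exact: is_cvg_einfs.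
  apply: nearW => n; apply: ge_ereal_inf.
  by exists (\int[nu]_t g n t)%E => //; exists n => /=.
(* The bound for N = 0 controls f - y_0 rather than f, so that difference is placed in L_p and y_0
   is added back. *)
have [w wP] : exists w : Lp, {ae nu, forall t, Lrepr w t = f t - Lrepr (y 0%N) t}.
  apply: Lspace_exists; first by apply: measurable_funB => //; exact: measurable_Lrepr.
  by rewrite (le_lt_trans (intf 0%N))// ltry.
exists (w + y 0%N) => N; rewrite -lee_fin (le_trans _ (intf N))//.
rewrite Lspace_norm_powR; apply: ae_ge0_le_integral => //.
- exact: measurable_powR_Lrepr.
- by apply/measurable_powR_norm/measurable_funB => //; exact: measurable_Lrepr.
apply: filterS3 wP (LreprD w (y 0%N)) (LreprB (w + y 0%N) (y N)) => t e1 e2 e3 _.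
by rewrite e3 e2 e1 subrK.
Qed.

(** At almost every point at most one term is nonzero, so the partial sums y_n are eventually
    constant there; disjointness gives |y_n - y_N|^p = |y_n|^p - |y_N|^p. *)
Lemma disjoint_series (u : nat -> Lp) (M : R) :
  (forall k l, k != l -> Ldisjoint (u k) (u l)) ->
  (forall n, `|\sum_(k < n) u k| `^ p <= M) ->
  exists z : Lp, forall N,
    `|z - \sum_(k < N) u k| `^ p <= M - `|\sum_(k < N) u k| `^ p.
Proof.
move=> du uM; pose y n := \sum_(k < n) u k.
have ydisj k n : (n <= k)%N -> Ldisjoint (u k) (y n).
  move=> nk; apply: Ldisjoint_sumr => -[i /= ni] _; apply: du.
  by rewrite gtn_eqF// (leq_trans ni).
apply: (@eventually_constant_limit y (fun N => M - `|y N| `^ p)).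
  have : {ae nu, forall t, forall n, Lrepr (y n.+1) t = Lrepr (y n) t + Lrepr (u n) t}.
    by apply: ae_foralln => n; rewrite /y big_ord_recr; exact: LreprD.
  have : {ae nu, forall t, forall k l, k != l -> Lrepr (u k) t * Lrepr (u l) t = 0}.
    apply: ae_foralln => k; apply: ae_foralln => l.
    have [->|kl] := eqVneq k l; first exact: nearW.
    by apply: filterS (du k l kl).
  apply: filterS2 => t ut yt.
  have [[k uk]|u0] := pselect (exists k, Lrepr (u k) t != 0); last first.
    exists 0%N => n _; elim: n => // n IH; rewrite yt IH.
    rewrite (_ : Lrepr (u n) t = 0) ?addr0//; apply/eqP/negPn/negP => un.
    by apply: u0; exists n.
  exists k.+1 => n /subnK <-; elim: (n - k.+1)%N => // m IH.
  rewrite addSn yt IH (_ : Lrepr (u _) t = 0) ?addr0//; apply/eqP.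
  have /ut/eqP : k != (m + k.+1)%N by rewrite ltn_eqF// addnS ltnS leq_addl.
  by rewrite mulf_eq0 (negPf uk).
move=> N n Nn; rewrite lerBrDr.
suff <- : `|y n| `^ p = `|y n - y N| `^ p + `|y N| `^ p by exact: uM.
rewrite -Ldisjoint_norm_powRD ?subrK//.
rewrite -(subnK Nn); elim: (n - N)%N => [|m IH].
  by rewrite subrr; exact/LdisjointC/Ldisjoint0.
rewrite addSn [y _.+1]big_ord_recr /= -/(y _) addrAC.
apply: LdisjointC; apply: LdisjointDr; first exact: LdisjointC.
by apply: LdisjointC; apply: ydisj; rewrite leq_addl.
Qed.

End disjoint_series.

(** * The copy of l_p(A) spanned by a disjoint family *)

Section disjoint_family.
Context d (T : measurableType d) (R : realType).
Variables (nu : {measure set T -> \bar R}) (p : R) (p1 : (1 <= p%:E)%E).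
Local Notation Lp := (LspaceType nu p1).
Context (A : choiceType).
Local Notation lp := (lp_space p1 A).
Variable x : A -> Lp.
Hypothesis normx : forall a, `|x a| = 1.
Hypothesis disjx : forall a b, a != b -> Ldisjoint (x a) (x b).
Let p_gt0 := exponent_gt0 p1.

Definition partial_sum (c : lp) (F : {fset A}) : Lp := \sum_(a <- F) c a *: x a.

(** Convergence along the finite subsets of [A] directed by inclusion, since [A] carries no
    enumeration. *)
Definition sums_to (c : lp) (y : Lp) := forall e : R, 0 < e ->
  exists F0 : {fset A}, forall F, (F0 `<=` F)%fset -> `|y - partial_sum c F| <= e.

Lemma partial_sum_norm c F :
  `|partial_sum c F| `^ p = \sum_(a <- F) `|c a| `^ p.
Proof.
rewrite /partial_sum Ldisjoint_norm_powR_sum//.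
  by apply: eq_bigr => a _; rewrite normrZ normx mulr1.
move=> a b _ _ ab; apply: LdisjointZr; apply: LdisjointC; apply: LdisjointZr.
by apply: LdisjointC; exact: disjx.
Qed.

Lemma partial_sum_disjoint c (F G : {fset A}) : [disjoint F & G]%fset ->
  Ldisjoint (partial_sum c F) (partial_sum c G).
Proof.
move=> FG; rewrite /partial_sum [in X in Ldisjoint _ X]big_seq.
apply: Ldisjoint_sumr => b bG; apply: LdisjointC; rewrite big_seq.
apply: Ldisjoint_sumr => a aF; apply: LdisjointZr; apply: LdisjointC.
apply: LdisjointZr; apply: disjx; apply: contraTneq bG => <-.
by move/fdisjointP: FG; exact.
Qed.

Lemma partial_sumD c (F G : {fset A}) : (F `<=` G)%fset ->
  partial_sum c G = partial_sum c F + partial_sum c (G `\` F)%fset.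
Proof.
move=> /fsubsetP FG; rewrite /partial_sum (big_fsetID _ (mem F)) /=.
congr (_ + _); apply: eq_fbigl => a; rewrite !inE/=; last by rewrite andbC.
by case: (boolP (a \in F)) => [/FG ->|]; rewrite ?andbF.
Qed.

Lemma partial_sum_linear (k : R) c c' F :
  partial_sum (k *: c + c') F = k *: partial_sum c F + partial_sum c' F.
Proof.
rewrite /partial_sum scaler_sumr -big_split; apply: eq_bigr => a _ /=.
by transitivity ((k * c a + c' a) *: x a); last by rewrite scalerDl scalerA.
Qed.

Lemma partial_sum_tail c (F G : {fset A}) : (F `<=` G)%fset ->
  `|partial_sum c G - partial_sum c F| `^ p <= `|c| `^ p - \sum_(a <- F) `|c a| `^ p.
Proof.
move=> FG; have := lp_sum_norm_ge c G.
rewrite -partial_sum_norm -(partial_sum_norm c F) (partial_sumD c FG) => cG.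
rewrite [partial_sum c F + _]addrC addrK lerBrDl -Ldisjoint_norm_powRD//.
apply: partial_sum_disjoint; apply/fdisjointP => a aF.
by rewrite !inE aF.
Qed.

(** Increasing finite sets that capture |c|^p in the limit cut the sum into disjoint blocks, to
    which [disjoint_series] applies; [partial_sum_tail] extends the estimate to every larger finite
    set. *)
Lemma sums_to_exists c : exists y, sums_to c y.
Proof.
have /choice[G GP] n : exists F : {fset A},
    `|c| `^ p - n.+1%:R^-1 < \sum_(a <- F) `|c a| `^ p.
  by apply: lp_sum_norm_approx; rewrite invr_gt0.
(* The sets start empty, so it is F(n+1) that contains G(n). *)
pose F := fix F n : {fset A} := if n is n.+1 then (F n `|` G n)%fset else fset0.
have FS n : (F n `<=` F n.+1)%fset by exact: fsubsetUl.
have Fle m n : (m <= n)%N -> (F m `<=` F n)%fset.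
  move=> /subnK <-; elim: (n - m)%N => // k IH.
  exact: fsubset_trans IH (FS _).
pose u n := partial_sum c (F n.+1 `\` F n)%fset.
have sumu n : \sum_(k < n) u k = partial_sum c (F n).
  elim: n => [|n IH]; first by rewrite big_ord0 /partial_sum big_seq_fset0.
  by rewrite big_ord_recr /= IH -partial_sumD.
have du k l : k != l -> Ldisjoint (u k) (u l).
  wlog kl : k l / (k < l)%N => [W|_].
    rewrite neq_ltn => /orP[kl|lk]; first by apply: W; rewrite ?ltn_eqF.
    by apply: LdisjointC; apply: W; rewrite ?ltn_eqF.
  apply: partial_sum_disjoint; apply/fdisjointP => a.
  rewrite !in_fsetD => /andP[_ aF].
  by rewrite (fsubsetP (Fle _ _ kl) _ aF).
have uM n : `|\sum_(k < n) u k| `^ p <= `|c| `^ p.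
  by rewrite sumu partial_sum_norm; exact: lp_sum_norm_ge.
have [y yP] := disjoint_series du uM; exists y => e e0.
have e2 : 0 < (e / 2) `^ p by rewrite powR_gt0// divr_gt0.
pose n := Num.truncn ((e / 2) `^ p)^-1.
have tail : `|c| `^ p - \sum_(a <- F n.+1) `|c a| `^ p <= (e / 2) `^ p.
  have GF : \sum_(a <- G n) `|c a| `^ p <= \sum_(a <- F n.+1) `|c a| `^ p.
    rewrite -!partial_sum_norm (@partial_sumD c (G n) (F n.+1)); last exact: fsubsetUr.
    rewrite Ldisjoint_norm_powRD ?lerDl ?powR_ge0//.
    apply: partial_sum_disjoint; apply/fdisjointP => a aG.
    by rewrite !inE aG.
  have nE : n.+1%:R^-1 <= (e / 2) `^ p.
    by rewrite -[leRHS]invrK lef_pV2 ?posrE ?invr_gt0// ltW// truncnS_gt.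
  have GPn : `|c| `^ p - n.+1%:R^-1 < \sum_(a <- G n) `|c a| `^ p := GP n.
  rewrite lerBlDr -lerBlDl (le_trans _ GF)// (le_trans _ (ltW GPn))//.
  by rewrite lerB.
exists (F n.+1) => H FH.
have -> : y - partial_sum c H = (y - partial_sum c (F n.+1)) -
    (partial_sum c H - partial_sum c (F n.+1)) by rewrite opprB addrA subrK.
have e20 : 0 <= e / 2 by rewrite ltW// divr_gt0.
rewrite (le_trans (ler_normB _ _))// [leRHS]splitr lerD//.
  apply: (powR_le_cancel p_gt0) => //.
  by have := yP n.+1; rewrite sumu partial_sum_norm => /le_trans; apply.
apply: (powR_le_cancel p_gt0) => //.
exact: le_trans (partial_sum_tail c FH) tail.
Qed.

Lemma sums_to_unique c y y' : sums_to c y -> sums_to c y' -> y = y'.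
Proof.
move=> cy cy'; apply/eqP; rewrite -subr_eq0 -normr_le0; apply/ler_addgt0Pl => e e0.
have e2 : 0 < e / 2 by rewrite divr_gt0.
have [F FP] := cy _ e2; have [F' F'P] := cy' _ e2.
have -> : y - y' = (y - partial_sum c (F `|` F')%fset) -
    (y' - partial_sum c (F `|` F')%fset) by rewrite opprB addrA subrK.
rewrite addr0 (le_trans (ler_normB _ _))// [leRHS]splitr lerD//.
  by apply: FP; exact: fsubsetUl.
by apply: F'P; exact: fsubsetUr.
Qed.

Lemma sums_to_linear (k : R) c c' y y' : sums_to c y -> sums_to c' y' ->
  sums_to (k *: c + c') (k *: y + y').
Proof.
move=> cy cy' e e0.
have k0 : 0 < `|k| + 1 by rewrite ltr_wpDl.
have e2 : 0 < e / 2 by rewrite divr_gt0.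
have [F FP] := cy _ (divr_gt0 e2 k0); have [F' F'P] := cy' _ e2.
exists (F `|` F')%fset => H; rewrite fsubUset => /andP[/FP yH /F'P y'H].
rewrite partial_sum_linear opprD addrACA -scalerBr.
rewrite (le_trans (ler_normD _ _))// [leRHS]splitr lerD// normrZ.
apply: (@le_trans _ _ (`|k| * (e / 2 / (`|k| + 1)))); first by rewrite ler_wpM2l.
by rewrite mulrCA ler_piMr ?ltW// ltr_pdivrMr// mul1r ltrDl.
Qed.

Lemma sums_to_norm c y : sums_to c y -> `|y| = `|c|.
Proof.
move=> cy; apply/eqP; rewrite eq_le; apply/andP; split.
  apply/ler_addgt0Pr => e e0; have [F FP] := cy e e0.
  have := FP F (fsubset_refl _); set s := partial_sum c F => ys.
  have sc : `|s| <= `|c|.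
    apply: (powR_le_cancel p_gt0) => //.
    by rewrite partial_sum_norm; exact: lp_sum_norm_ge.
  by rewrite -(subrK s y) (le_trans (ler_normD _ _))// addrC lerD.
rewrite leNgt; apply/negP => yc.
(* r is the midpoint of |y| and |c|. A partial sum over a large finite set has norm above r, as it
   nearly exhausts c, yet at most |y| + e = r, as it is within e of y. *)
pose e := (`|c| - `|y|) / 2; pose r := `|y| + e.
have e0 : 0 < e by rewrite divr_gt0// subr_gt0.
have r0 : 0 <= r by rewrite addr_ge0// ltW.
have rc : r `^ p < `|c| `^ p.
  by apply: gt0_ltr_powR; rewrite ?nnegrE// /r /e; lra.
have [F rF] : exists F : {fset A}, r `^ p < \sum_(a <- F) `|c a| `^ p.
  have rc0 : 0 < `|c| `^ p - r `^ p by rewrite subr_gt0.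
  by have [F] := lp_sum_norm_approx c rc0; rewrite subKr; exists F.
have [F' F'P] := cy _ e0.
have := F'P (F `|` F')%fset (fsubsetUr _ _); set s := partial_sum c _ => ys.
have sr : r < `|s|.
  rewrite ltNge; apply/negP => sr.
  have : `|s| `^ p <= r `^ p by rewrite ge0_ler_powR ?nnegrE// ltW.
  apply/negP; rewrite -ltNge (lt_le_trans rF)//.
  rewrite -partial_sum_norm /s (partial_sumD c (fsubsetUl F F')).
  rewrite Ldisjoint_norm_powRD ?lerDl ?powR_ge0//.
  by apply: partial_sum_disjoint; apply/fdisjointP => a aF; rewrite !inE aF.
have : `|s| <= `|y| + `|y - s|.
  by rewrite -{1}(subKr y s) ler_normB.
by move: sr ys; rewrite /r; lra.
Qed.

(** The embedding sends c to the sum of the c_a x_a, which lies in [X] as a limit of finite partial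
    sums. *)
Lemma disjoint_family_embeds (X : set Lp) : closed_subspace X ->
  (forall a, X (x a)) -> embeds_isometrically lp X.
Proof.
move=> [Xcl X0 XD] Xx.
have [U UP] := choice sums_to_exists.
have Ulin : linear U.
  by move=> k c c'; apply: sums_to_unique (UP _) _; exact: sums_to_linear.
pose Ul : {linear lp -> Lp} := HB.pack U (GRing.isLinear.Build R lp Lp *:%R U Ulin).
have XF c F : X (partial_sum c F).
  rewrite /partial_sum; elim/big_rec: _ => // a y _ Xy; exact: XD.
exists Ul => [c|_ [c _ <-]]; first exact: sums_to_norm.
apply: ((closed_approxP X).1 Xcl) => e e0.
have e2 : 0 < e / 2 by rewrite divr_gt0.
have [F FP] := UP c _ e2; exists (partial_sum c F) => //.
apply: le_lt_trans (FP F (fsubset_refl _)) _.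
by rewrite ltr_pdivrMr// ltr_pMr// ltr1n.
Qed.

End disjoint_family.

(** * Restriction to a set of finite measure *)

Section restriction.
Context d (T : measurableType d) (R : realType).
Variables (nu : {measure set T -> \bar R}) (p : R) (p1 : (1 <= p%:E)%E).
Variables (D : set T) (mD : measurable D) (Doo : (nu D < +oo)%E).
Let mu : {finite_measure set T -> \bar R} := mfrestr mD Doo.

Lemma ae_mfrestr (P : T -> Prop) :
  {ae nu, forall t, P t} -> {ae mu, forall t, P t}.
Proof.
move=> [N [mN N0 PN]]; exists N; split=> //.
have ND : measurable (N `&` D) by exact: measurableI.
by apply: (subset_measure0 ND mN _ N0) => t [].
Qed.

Lemma ae_mfrestr_setT (P : T -> Prop) :
  {ae mu, forall t, P t} -> {ae nu, forall t, D t -> P t}.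
Proof.
move=> [N [mN N0 PN]]; exists (N `&` D); split=> [||t /= /not_implyP[Dt nP]].
- exact: measurableI.
- exact: N0.
- by split=> //; exact: PN.
Qed.

(** For the restricted measure f agrees almost everywhere with 1_D f, and [nu] is the sum of its
    restrictions to D and to the complement of D. *)
Lemma integral_mfrestr_le (f : T -> R) : measurable_fun [set: T] f ->
  (forall t, 0 <= f t) ->
  (\int[mu]_t (f t)%:E <= \int[nu]_t (\1_D t * f t)%:E)%E.
Proof.
move=> mf f0; pose g t := (\1_D t * f t)%:E.
have mg : measurable_fun [set: T] g.
  by apply/measurable_EFinP/measurable_funM => //; exact: measurable_indic.
have g0 t : (0 <= g t)%E by rewrite lee_fin mulr_ge0.
have -> : (\int[mu]_t (f t)%:E = \int[mu]_t g t)%E.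
  apply: ge0_ae_eq_integral => //.
  - exact/measurable_EFinP.
  - by move=> t _; rewrite lee_fin.
  exists (~` D); split; first exact: measurableC.
    by rewrite /mu /= /mfrestr /mrestr setICl measure0.
  move=> t /= /not_implyP[_ fg] Dt; apply: fg.
  by rewrite /g indicE mem_set// mul1r.
have mDc := measurableC mD.
have -> : (\int[nu]_t g t = \int[measure_add (mrestr nu mD) (mrestr nu mDc)]_t g t)%E.
  apply: eq_measure_integral => B mB _.
  transitivity (mrestr nu mD B + mrestr nu mDc B)%E; last first.
    exact: esym (measure_addE (mrestr nu mD) (mrestr nu mDc) B).
  rewrite /mrestr -measureU//.
  - by rewrite -setIUr setUv setIT.
  - exact: measurableI.
  - exact: measurableI.
  - by rewrite setIACA setICr setI0.
rewrite ge0_integral_measure_add// leeDl//.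
exact: integral_ge0.
Qed.

(** A representative is kept and read modulo the null sets of the restricted measure. The bound
    retains the indicator of [D], to be summed over disjoint sets. *)
Lemma Lspace_restriction : exists r : LspaceType nu p1 -> LspaceType mu p1,
  [/\ linear r,
      forall v, ((`|r v| `^ p)%:E <= \int[nu]_t (\1_D t * `|Lrepr v t| `^ p)%:E)%E &
      forall v, r v = 0 -> {ae nu, forall t, D t -> Lrepr v t = 0}].
Proof.
have mN (v : LspaceType nu p1) : measurable_fun [set: T] (fun t => `|Lrepr v t| `^ p).
  by apply/measurable_EFinP; exact: measurable_powR_Lrepr.
have N0 (v : LspaceType nu p1) t : 0 <= `|Lrepr v t| `^ p by exact: powR_ge0.
have rE (v : LspaceType nu p1) : exists w : LspaceType mu p1,
    {ae mu, forall t, Lrepr w t = Lrepr v t}.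
  apply: Lspace_exists; first exact: (@measurable_Lrepr _ _ _ nu p p1 v).
  apply: le_lt_trans (integral_mfrestr_le (mN v) (N0 v)) _.
  apply: (@le_lt_trans _ _ (`|v| `^ p)%:E); last exact: ltry.
  rewrite Lspace_norm_powR; apply: ge0_le_integral => //.
  - by apply/measurable_EFinP/measurable_funM => //; exact: measurable_indic.
  - exact: measurable_powR_Lrepr.
  - by move=> t _; rewrite lee_fin ler_piMl ?powR_ge0// indicE lern1 leq_b1.
have [r rP] := choice rE.
exists r; split=> [k x y|v|v rv].
- apply/Lspace_eqP.
  have E1 : {ae mu, forall t, Lrepr (r (k *: x + y)) t = k * Lrepr x t + Lrepr y t}.
    apply: filterS3 (rP (k *: x + y)) (ae_mfrestr (LreprD (k *: x) y))
      (ae_mfrestr (LreprZ k x)) => t -> -> -> //.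
  have E2 : {ae mu, forall t, Lrepr (k *: r x + r y) t = k * Lrepr (r x) t + Lrepr (r y) t}.
    by apply: filterS2 (LreprD (k *: r x) (r y)) (LreprZ k (r x)) => t -> ->.
  have E3 : {ae mu, forall t, Lrepr (r x) t = Lrepr x t /\ Lrepr (r y) t = Lrepr y t}.
    by apply: filterS2 (rP x) (rP y) => t -> ->.
  by apply: filterS3 E1 E2 E3 => t -> -> [-> ->].
- apply: le_trans (integral_mfrestr_le (mN v) (N0 v)).
  rewrite Lspace_norm_powR; rewrite le_eqVlt; apply/orP; left; apply/eqP.
  apply: ge0_ae_eq_integral => //.
  + exact: measurable_powR_Lrepr.
  + by apply/measurable_EFinP; exact: mN.
  + by apply: filterS (rP v) => t ->.
- apply: ae_mfrestr_setT; have := (Lspace_eq0P (r v)).1 rv.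
  by apply: filterS2 (rP v) => t -> ->.
Qed.

End restriction.

(** * Annuli and the injection given by a maximal family *)

Section annuli.
Context d (T : measurableType d) (R : realType).
Variables (nu : {measure set T -> \bar R}) (p : R) (p1 : (1 <= p%:E)%E).
Local Notation Lp := (LspaceType nu p1).
Implicit Types (x y : Lp).
Let p_gt0 := exponent_gt0 p1.

(** The set 1/(n+1) <= |x| < 1/n, multiplied out so that n = 0 gives |x| >= 1. The annuli of x
    partition its support. *)
Definition annulus x n := [set t | 1 <= n.+1%:R * `|Lrepr x t|] `\`
  [set t | 1 <= n%:R * `|Lrepr x t|].

Let mlevel x (n : nat) : measurable [set t | 1 <= n%:R * `|Lrepr x t|].
Proof.
have mx : measurable_fun [set: T] (fun t => n%:R * `|Lrepr x t|).
  have mL := measurable_Lrepr x.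
  by apply: measurable_funM => //; exact: measurableT_comp.
have := mx measurableT _ (measurable_itv `[(1 : R), +oo[).
rewrite setTI; congr measurable; apply/seteqP.
by split=> t /=; rewrite in_itv/= andbT.
Qed.

Lemma measurable_annulus x n : measurable (annulus x n).
Proof. exact: measurableD. Qed.

(** Markov's inequality: (n+1)^p |x|^p is integrable and at least 1 there. *)
Lemma annulus_finite x n : (nu (annulus x n) < +oo)%E.
Proof.
have mE := measurable_annulus x n.
rewrite -[annulus x n]setIT -integral_indic//.
apply: (@le_lt_trans _ _ (\int[nu]_t ((n.+1%:R `^ p)%:E * (`|Lrepr x t| `^ p)%:E))%E).
  apply: ge0_le_integral => //.
  - by apply/measurable_EFinP; exact: measurable_indic.
  - by apply: measurable_funeM; exact: measurable_powR_Lrepr.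
  move=> t _; rewrite -EFinM lee_fin -powRM// indicE.
  have [/set_mem[+ _]|_] := boolP (t \in _); last exact: powR_ge0.
  move=> /= t1; have -> : true%:R = 1 `^ p :> R by rewrite powR1.
  by rewrite ge0_ler_powR ?nnegrE ?(ltW p_gt0).
rewrite ge0_integralZl//; last exact: measurable_powR_Lrepr.
by rewrite -Lspace_norm_powR -EFinM ltry.
Qed.

Lemma annulus_support x n t : annulus x n t -> Lsupport x t.
Proof.
move=> [+ _]; rewrite /= /Lsupport /=; apply: contraTneq => ->.
by rewrite normr0 mulr0 ler10.
Qed.

Lemma annulus_disjoint x m n t : m != n -> ~ (annulus x m t /\ annulus x n t).
Proof.
wlog mn : m n / (m < n)%N => [W|_].
  by rewrite neq_ltn => /orP[mn|nm]; [|rewrite and_comm]; apply: W; rewrite ?ltn_eqF.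
move=> [[/= m1 _] [_ /= n1]]; apply: n1; apply: le_trans m1 _.
by rewrite ler_wpM2r// ler_nat.
Qed.

Lemma annulus_exists x t : Lsupport x t -> exists n, annulus x n t.
Proof.
rewrite /Lsupport /= => xt; have x0 : 0 < `|Lrepr x t| by rewrite normr_gt0.
have ex : exists n, 1 <= n%:R * `|Lrepr x t|.
  exists (Num.truncn `|Lrepr x t|^-1).+1.
  by rewrite -ler_pdivrMr// mul1r ltW// truncnS_gt.
case: (ex_minnP ex) => -[|n] n1 nmin; first by move: n1; rewrite mul0r ler10.
by exists n; split=> //= /nmin; rewrite ltnn.
Qed.

(** The map restricts v to every annulus of every member of G; these sets are disjoint up to null
    sets, so it is contractive into the l_p-sum. If all restrictions of an element of [X] vanish, it
    is disjoint from every member of [G], hence zero by maximality. *)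
Lemma maximal_family_injection (X G : set Lp) :
  closed_subspace X -> (forall x y, G x -> G y -> x <> y -> Ldisjoint x y) ->
  (forall z, X z -> z <> 0 -> exists2 x, G x & ~ Ldisjoint x z) ->
  exists (mu : set_type G * nat -> {finite_measure set T -> \bar R})
    (f : Lp -> lp_sum (fun i => LspaceType (mu i) p1) p1),
    bounded_linear_on X f /\ set_inj X f.
Proof.
move=> [_ X0 XD] Gd Gmax.
pose B (i : set_type G * nat) := annulus (val i.1) i.2.
have mB i : measurable (B i) by exact: measurable_annulus.
have Boo i : (nu (B i) < +oo)%E by exact: annulus_finite.
pose mu i : {finite_measure set T -> \bar R} := mfrestr (mB i) (Boo i).
have dB i j : i != j -> {ae nu, forall t, ~ (B i t /\ B j t)}.
  case: i j => [x m] [y n] xymn; have [xy|xy] := eqVneq x y.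
    apply: nearW => t; rewrite /B /= xy; apply: annulus_disjoint.
    by apply: contraNneq xymn => ->; rewrite xy.
  have /Ldisjoint_supportP : Ldisjoint (val x) (val y).
    apply: Gd; [exact: set_valP|exact: set_valP|].
    by move=> /val_inj xyE; move: xy; rewrite xyE eqxx.
  by apply: filterS => t nt [/annulus_support sx /annulus_support sy]; apply: nt.
pose r i := sval (cid (Lspace_restriction p1 (mB i) (Boo i))).
have rP i : [/\ linear (r i),
    forall v, ((`|r i v| `^ p)%:E <= \int[nu]_t (\1_(B i) t * `|Lrepr v t| `^ p)%:E)%E &
    forall v, r i v = 0 -> {ae nu, forall t, B i t -> Lrepr v t = 0}].
  exact: svalP (cid (Lspace_restriction p1 (mB i) (Boo i))).
exists mu.
have sum_r v (F : {fset set_type G * nat}) : \sum_(i <- F) `|r i v| `^ p <= `|v| `^ p.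
  rewrite -lee_fin -sumEFin.
  apply: (@le_trans _ _ (\sum_(i <- F)
      \int[nu]_t (\1_(B i) t * `|Lrepr v t| `^ p)%:E)%E).
    by apply: lee_sum => i _; have [_ + _] := rP i; exact.
  apply: sum_integral_ae_disjoint => // i j _ _; exact: dB.
have r_summable v : pth_summable (E := fun i => LspaceType (mu i) p1) p (fun i => r i v).
  by apply: (le_lt_trans (pth_power_sum_le (sum_r v))); exact: ltry.
pose f v : lp_sum (fun i => LspaceType (mu i) p1) p1 := LpSum p1 (r_summable v).
have flin (k : R) x y : f (k *: x + y) = k *: f x + f y.
  by apply: lp_sum_inj => i /=; have [rlin _ _] := rP i; exact: rlin.
have f0 v : X v -> f v = 0 -> v = 0.
  move=> Xv fv; apply: contrapT => v0; have [x Gx []] := Gmax v Xv v0.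
  (* With x fixed, only countably many null sets are united. *)
  have : {ae nu, forall t, forall n, annulus x n t -> Lrepr v t = 0}.
    apply: ae_foralln => n.
    have [_ _ r0] := rP (SigSub (mem_set Gx), n).
    have : r (SigSub (mem_set Gx), n) v = 0.
      by have := congr1 (fun w : lp_sum (fun i => LspaceType (mu i) p1) p1 =>
        w (SigSub (mem_set Gx), n)) fv.
    by move/r0.
  apply: filterS => t vt; apply/eqP; rewrite mulf_eq0.
  have [//|/annulus_exists[n xn]] := eqVneq (Lrepr x t) 0.
  by rewrite (vt n xn) eqxx orbT.
exists f; split.
  split=> [k x y _ _|]; first exact: flin.
  exists 1 => v _; rewrite mul1r.
  have fv : `|f v| `^ p <= `|v| `^ p.
    rewrite -lee_fin (lp_sum_norm_powRE (f v)); exact: pth_power_sum_le (sum_r v).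
  exact: (powR_le_cancel p_gt0).
move=> x y /set_mem Xx /set_mem Xy fxy; apply/eqP; rewrite -subr_eq0; apply/eqP.
have xyE : x - y = -1 *: y + x by rewrite scaleN1r addrC.
apply: f0; rewrite xyE; first exact: XD.
by rewrite flin fxy scaleN1r addNr.
Qed.

End annuli.

(** * Counting a maximal disjoint family, and the equivalence *)

Lemma no_injection_embeds (R : realType) (p : R) (p1 : (1 <= p%:E)%E)
    (d : measure_display) (T : measurableType d) (nu : {measure set T -> \bar R})
    (X : set (LspaceType nu p1)) (A : choiceType) :
  closed_subspace X -> ~ countable [set: A] ->
  (~ exists (K : Type) (Z : normedModType R) (f : LspaceType nu p1 -> Z),
       [/\ infinite_set [set: K], card_lt K A, Lp_card_space p1 K Z,
           bounded_linear_on X f & set_inj X f]) ->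
  embeds_isometrically (lp_space p1 A) X.
Proof.
move=> Xsub A_unc noinj; have [Xcl X0 XD] := Xsub.
have [G [GX Gd Gmax]] := maximal_disjoint (@Ldisjoint _ T R nu p p1)
  [set x | X x /\ x <> 0].
have {}Gmax z : X z -> z <> 0 -> exists2 x, G x & ~ Ldisjoint x z.
  move=> Xz z0; have [Gz|nGz] := pselect (G z); first by exists z => // /Ldisjointxx.
  have [x Gx nd] := Gmax z (conj Xz z0) nGz; exists x => // dxz.
  by apply: nd; split=> //; exact: LdisjointC.
have [AG|nAG] := pselect ([set: A] #<= [set: set_type G])%card.
  have /card_leT_injP[h hinj] := AG.
  have Gh a : G (val (h a)) by exact: set_valP.
  have h0 a : `|val (h a)| != 0 by rewrite normr_eq0; apply/eqP; exact: (GX _ (Gh a)).2.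
  apply: (@disjoint_family_embeds _ _ _ _ _ _ _ (fun a => `|val (h a)|^-1 *: val (h a))) => //.
  - by move=> a; rewrite normrZ normfV normr_id mulVf.
  - move=> a b ab; apply: LdisjointZr; apply: LdisjointC; apply: LdisjointZr.
    apply: LdisjointC; apply: Gd => // /val_inj/hinj abE.
    by rewrite abE eqxx in ab.
  - move=> a; rewrite -[_ *: _]addr0; apply: XD => //.
    exact: (GX _ (Gh a)).1.
exfalso; apply: noinj.
have [mu [f [fbnd finj]]] := maximal_family_injection Xsub Gd Gmax.
have Lp_card (K : Type) : ([set: set_type G * nat] #<= [set: K])%card ->
    Lp_card_space p1 K (lp_sum (fun i => LspaceType (mu i) p1) p1).
  move=> GK; exists (set_type G * nat)%type, (fun=> d), (fun=> T), mu; split=> //.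
  by exists idfun => //; apply/seteqP; split=> // y _; exists y.
(* K must be infinite, smaller than A and at least G x nat: [nat] serves for countable G, since A is
   uncountable; otherwise G itself absorbs the factor [nat]. *)
have [Gc|Gunc] := pselect (countable [set: set_type G]).
  exists nat, (lp_sum (fun i => LspaceType (mu i) p1) p1), f; split=> //.
  - exact: infinite_nat.
  - by split=> //; apply/infiniteP => /finite_set_countable.
  - apply: Lp_card; have := countableX Gc (countableP [set: nat]).
    by rewrite setXTT.
have Goo : infinite_set [set: set_type G] by move=> /finite_set_countable.
exists (set_type G), (lp_sum (fun i => LspaceType (mu i) p1) p1), f; split=> //.
  by split=> //; have [] := card_leT_total (set_type G) A.
exact/Lp_card/card_leT_Xnat.
Qed.

Theorem proposition2 (R : realType) (p : R) (p_gt2 : 2 < p)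
    (d : measure_display) (T : measurableType d)
    (nu : {measure set T -> \bar R})
    (X : set (LspaceType nu (lee1_gt2 p_gt2))) (X_sub : closed_subspace X)
    (A : choiceType) (A_unc : ~ countable [set: A]) :
  [<-> embeds_isometrically (lp_space (lee1_gt2 p_gt2) A) X;
       exists Y : set (LspaceType nu (lee1_gt2 p_gt2)),
         [/\ closed_subspace Y, Y `<=` X,
             isomorphic_to (lp_space (lee1_gt2 p_gt2) A) Y & complemented Y];
       embeds_isomorphically (lp_space (lee1_gt2 p_gt2) A) X;
       ~ exists (K : Type) (Z : normedModType R)
           (f : LspaceType nu (lee1_gt2 p_gt2) -> Z),
           [/\ infinite_set [set: K], card_lt K A,
               Lp_card_space (lee1_gt2 p_gt2) K Z,
               bounded_linear_on X f & set_inj X f]].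
Proof.
tfae.
- move=> [U Uiso UX]; have [Ucl Ucompl] := isometric_complemented p_gt2 Uiso.
  exists (range U); split=> //.
  by exists U => //; exists 1 => //; exists 1 => v; rewrite !mul1r Uiso.
- by move=> [Y [_ YX [U Uiso UY] _]]; exists U => //; rewrite UY.
- move=> Aemb [K [Z [f [Koo [_ nAK] ZK fbnd finj]]]].
  exact: (isomorphic_no_injection p_gt2 X_sub Aemb Koo nAK ZK fbnd finj).
- exact: no_injection_embeds.
Qed.
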